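(* Let $d\ge 1$ be an integer, $\beta\in(0,1]$, $\alpha>0$ with $\alpha\beta\le 1$, and $L>0$, and put $\gamma=\frac{\beta(1+\alpha)}{2\beta+d}\in(0,1)$. Assume that $P_X$ is the uniform distribution on $\mathcal X=[0,1]^d$. There are constants $D_0>0$, $\delta_0\in(0,1)$ (the constants in the class $\mathcal F(\alpha,\beta)$) and $\tilde D>0$, all independent of $T$ and $M$, such that for all integers $T\ge M\ge 1$ the following holds. For every $M$-batch policy $(\Gamma,\pi)$ with horizon $T$ whose grid $\Gamma=\{t_0,t_1,\dots,t_M\}$ is prespecified (deterministic, fixed before the game starts), there exists a nonparametric bandit instance in $\mathcal F(\alpha,\beta)$ (with covariate distribution $P_X$) on which $$R_T(\pi)\ \ge\ \tilde D\, T^{\frac{1-\gamma}{1-\gamma^{M}}}.$$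
   Context: **Bandit instance.** A two-arm nonparametric bandit with horizon $T$ is given by i.i.d. random vectors $(X_t,Y_t^{(1)},Y_t^{(-1)})$, $t=1,\dots,T$, where $X_t\in\mathcal X=[0,1]^d$ has law $P_X$, $Y_t^{(k)}\in[0,1]$, and $\mathbb E[Y_t^{(k)}\mid X_t]=f^{(k)}(X_t)$ for $k\in\{1,-1\}$. Here $P_X$ has a Lebesgue density bounded below and above by positive constants. Write $f^\star(x)=\max_{k\in\{1,-1\}}f^{(k)}(x)$. **Class $\mathcal F(\alpha,\beta)$.** The set of bandit instances such that, with constants $L>0$, $D_0>0$, $\delta_0\in(0,1)$: (Smoothness) $|f^{(k)}(x)-f^{(k)}(x')|\le L\|x-x'\|_2^\beta$ for all $x,x'\in\mathcal X$ and $k\in\{1,-1\}$; (Margin) $\mathbb P_X\big(0<|f^{(1)}(X)-f^{(-1)}(X)|\le\delta\big)\le D_0\delta^\alpha$ for all $\delta\in[0,\delta_0]$. **$M$-batch policy.** A pair $(\Gamma,\pi)$ where $\Gamma=\{t_0,\dots,t_M\}$ with $0=t_0<t_1<\dots<t_{M-1}<t_M=T$, and $\pi=(\pi_t)_{t=1}^T$ is a sequence of random functions $\pi_t:\mathcal X\to\{1,-1\}$. At time $t$ the arm $A_t=\pi_t(X_t)$ is pulled. Let $\Gamma(t)$ be the integer with $t_{\Gamma(t)-1}<t\le t_{\Gamma(t)}$. The rule $\pi_t$ may depend only on the covariates $X_1,\dots,X_t$ and on the rewards $Y_l^{(A_l)}$, $1\le l\le t_{\Gamma(t)-1}$ (rewards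 from earlier batches). **Regret.** $R_T(\pi)=\mathbb E\big[\sum_{t=1}^T\big(f^\star(X_t)-f^{(\pi_t(X_t))}(X_t)\big)\big]$. *)

(* Defs.v *)
From HB Require Import structures.
From mathcomp Require Import all_boot all_order all_algebra.
From mathcomp Require Import all_classical all_reals all_analysis.

Set Implicit Arguments.
Unset Strict Implicit.
Unset Printing Implicit Defensive.

Import Order.TTheory GRing.Theory Num.Theory.
Import numFieldNormedType.Exports.

Local Open Scope classical_set_scope.
Local Open Scope ring_scope.

Section product_power.
Context {d : measure_display} {T : measurableType d} {R : realType}.

Definition cons_pair (n : nat) (z : T * n.-tuple T) : n.+1.-tuple T :=
  [the n.+1.-tuple T of z.1 :: z.2].

Lemma measurable_cons_pair n : measurable_fun setT (@cons_pair n).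
Proof. exact: measurable_cons. Qed.

HB.instance Definition _ n :=
  isMeasurableFun.Build _ _ _ _ (@cons_pair n) (@measurable_cons_pair n).

(* The law of [n] independent random elements with common law [P]. *)
Fixpoint iid_law (P : probability T R) (n : nat) : probability (n.-tuple T) R :=
  match n with
  | 0 => [the probability _ _ of \d_([tuple] : 0.-tuple T)]
  | m.+1 => [the probability _ _ of
      distribution [the probability _ _ of (P \x iid_law P m)%E] (@cons_pair m)]
  end.

Lemma iid_law_box (P : probability T R) n (A : 'I_n -> set T) :
    (forall i, measurable (A i)) ->
  iid_law P n [set x | forall i, A i (tnth x i)] = (\prod_(i < n) P (A i))%E.
Proof.
elim: n A => [|n IH] A mA.
 rewrite big_ord0 /= diracE.
 by rewrite mem_set //= => -[].
rewrite big_ord_recl /= /pushforward.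
rewrite [X in product_measure1 _ _ X](_ : _ = A ord0 `*` [set x | forall i, A (lift ord0 i) (tnth x i)]).
  rewrite product_measure1E//; last first.
    rewrite [X in measurable X](_ : _ = \bigcap_(i in [set: 'I_n]) ((fun x : n.-tuple T => tnth x i) @^-1` (A (lift ord0 i)))).
      apply: fin_bigcap_measurable => // i _.
      by rewrite -[X in measurable X]setTI; exact: (measurable_tnth i).
    by apply/seteqP; split => x /=; [move=> h i _; exact: h|move=> h i; exact: (h i)].
  by congr (_ * _)%E; apply: (IH (fun i => A (lift ord0 i))) => i; exact: mA.
apply/seteqP; split => -[a x] /=.
  move=> h; split=> [|i]; first by have := h ord0.
  by have := h (lift ord0 i); rewrite /cons_pair tnthS.
move=> [h1 h2] i; case: (unliftP ord0 i) => [j|] ->; last by [].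
by rewrite /cons_pair tnthS; exact: h2.
Qed.

End product_power.

(* [0,1]^d is encoded as a subset of R^d, viewed as [d.-tuple R]. *)
Definition covariate (R : realType) (d : nat) : measurableType _ :=
  d.-tuple (measurableTypeR R).

Definition cube (R : realType) (d : nat) : set (covariate R d) :=
  [set x | forall i, 0 <= tnth x i <= 1].
Arguments cube : clear implicits.

Definition l2_dist (R : realType) (d : nat) (x y : covariate R d) : R :=
  Num.sqrt (\sum_(i < d) (tnth x i - tnth y i) ^+ 2).

(* The uniform distribution on [cube R d]; since the cube has unit volume, this
   is also the restriction to it of the d-dimensional Lebesgue measure. *)
Definition cube_uniform (R : realType) (d : nat) : probability (covariate R d) R :=
  iid_law [the probability (measurableTypeR R) R of uniform_prob (@ltr01 R)] d.
Arguments cube_uniform : clear implicits.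

(* The arms 1 and -1 are [true] and [false].  An observation (x, (y, y')) holds
   the covariate x, the reward y of arm 1 and the reward y' of arm -1. *)
Definition observation (R : realType) (d : nat) : measurableType _ :=
  (covariate R d * (measurableTypeR R * measurableTypeR R))%type.

Definition reward (R : realType) (d : nat) (k : bool) (z : observation R d) : R :=
  if k then z.2.1 else z.2.2.

Definition covariate_law (R : realType) (d : nat)
    (Q : probability (observation R d) R) : set (covariate R d) -> \bar R :=
  pushforward Q fst.

(* The observations at times 1, ..., T being i.i.d., an instance is determined
   by the law of a single one.  [mean_reward_law] is the defining property of
   E[Y^(k) | X] = f^(k)(X).  Only the restriction of [mean_reward k] to the cube
   is meaningful: [law] puts no mass elsewhere, by [density_law]. *)
Record bandit_instance (R : realType) (d : nat) := BanditInstance {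
  law : probability (observation R d) R;
  mean_reward : bool -> covariate R d -> R;
  mean_reward_measurable : forall k, measurable_fun setT (mean_reward k);
  reward_bounded : forall k, {ae law, forall z, 0 <= reward k z <= 1};
  mean_reward_law : forall k (A : set (covariate R d)), measurable A ->
    (\int[law]_(z in fst @^-1` A) (reward k z)%:E =
     \int[law]_(z in fst @^-1` A) (mean_reward k z.1)%:E)%E;
  density_law : exists (c C : R) (p : covariate R d -> R),
    [/\ 0 < c, measurable_fun setT p,
        forall x, cube R d x -> c <= p x <= C &
        forall A, measurable A ->
          covariate_law law A = (\int[cube_uniform R d]_(x in A) (p x)%:E)%E]
}.

Definition best_mean (R : realType) (d : nat) (I : bandit_instance R d)
    (x : covariate R d) : R :=
  Num.max (mean_reward I true x) (mean_reward I false x).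

Definition smooth (R : realType) (d : nat) (beta L : R) (I : bandit_instance R d) :=
  forall k (x x' : covariate R d), cube R d x -> cube R d x' ->
    `|mean_reward I k x - mean_reward I k x'| <= L * l2_dist x x' `^ beta.

Definition margin (R : realType) (d : nat) (alpha D0 delta0 : R)
    (I : bandit_instance R d) :=
  forall delta : R, 0 <= delta <= delta0 ->
    (covariate_law (law I)
       [set x | (0 < `|mean_reward I true x - mean_reward I false x| <= delta)%R]
     <= (D0 * delta `^ alpha)%R%:E)%E.

Definition bandit_class (R : realType) (d : nat) (alpha beta L D0 delta0 : R) :
    set (bandit_instance R d) :=
  [set I | smooth beta L I /\ margin alpha D0 delta0 I].

Definition uniform_covariates (R : realType) (d : nat) (I : bandit_instance R d) :=
  forall A : set (covariate R d), measurable A ->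
    covariate_law (law I) A = cube_uniform R d A.

Definition is_grid (T M : nat) (t : seq nat) : Prop :=
  [/\ size t = M.+1, nth 0 t 0 = 0, nth 0 t M = T & sorted ltn t]%N.

(* Times are counted from 0: [rule s] is the function pi_(s+1), and batch i
   consists of the indices s with t_i <= s < t_(i+1).  [rule s u xs ys x] is the
   arm chosen at covariate x, given the covariates xs and the rewards ys; it may
   only look at the entries of xs up to s and at the entries of ys from the
   earlier batches.  The policy may be randomized: u is a seed drawn
   independently of the observations. *)
Record batch_policy (R : realType) (d T M : nat) (t : seq nat) := BatchPolicy {
  seed_display : measure_display;
  seed : measurableType seed_display;
  seed_law : probability seed R;
  rule : nat -> seed -> T.-tuple (covariate R d) ->
         T.-tuple (measurableTypeR R) -> covariate R d -> bool;
  rule_measurable : forall s, (s < T)%N ->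
    measurable_fun setT
      (fun w : seed * T.-tuple (covariate R d) * T.-tuple (measurableTypeR R)
               * covariate R d => rule s w.1.1.1 w.1.1.2 w.1.2 w.2);
  rule_batched : forall i s, (i < M)%N -> (nth 0 t i <= s < nth 0 t i.+1)%N ->
    forall u (xs xs' : T.-tuple (covariate R d))
      (ys ys' : T.-tuple (measurableTypeR R)) x,
    (forall l : 'I_T, (l <= s)%N -> tnth xs l = tnth xs' l) ->
    (forall l : 'I_T, (l < nth 0 t i)%N -> tnth ys l = tnth ys' l) ->
    rule s u xs ys x = rule s u xs' ys' x
}.

Section play.
Context {R : realType} {d T M : nat} {t : seq nat}.
Variables (pi : batch_policy R d T M t) (u : seed pi)
  (z : T.-tuple (observation R d)).

Definition covariates : T.-tuple (covariate R d) := [tuple of map fst z].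

(* Unobserved rewards are filled with 0; by [rule_batched] they do not matter. *)
Definition arm_given (ys : seq R) (s : 'I_T) : bool :=
  rule s u covariates [tuple nth 0 ys l | l < T] (tnth z s).1.

(* The rewards collected at the first [n] times. *)
Fixpoint collected (n : nat) : seq R :=
  match n with
  | 0 => [::]
  | m.+1 => rcons (collected m)
      (if insub m is Some s
       then reward (arm_given (collected m) s) (tnth z s) else 0)
  end.

Definition arm_pulled (s : 'I_T) : bool := arm_given (collected s) s.

End play.

Definition realized_regret (R : realType) (d T M : nat) (t : seq nat)
    (I : bandit_instance R d) (pi : batch_policy R d T M t)
    (w : seed pi * T.-tuple (observation R d)) : R :=
  \sum_(s < T) (best_mean I (tnth w.2 s).1
                 - mean_reward I (arm_pulled w.1 w.2 s) (tnth w.2 s).1).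

Arguments realized_regret {R d T M t} I pi w.

Definition regret (R : realType) (d T M : nat) (t : seq nat)
    (I : bandit_instance R d) (pi : batch_policy R d T M t) : \bar R :=
  ('E_(seed_law pi \x iid_law (law I) T)%E[realized_regret I pi])%E.

(* Main.v *)
From HB Require Import structures.
Require Import Defs.
From mathcomp Require Import all_boot all_order all_algebra.
From mathcomp Require Import all_classical all_reals all_analysis.
From mathcomp Require Import measurable_realfun ring lra.
Import Order.TTheory GRing.Theory Num.Theory.
Local Open Scope classical_set_scope.
Local Open Scope ring_scope.

(* Arm -1 always pays 1/2, and arm 1 pays a Bernoulli reward of mean
   1/2 + sum_j sigma_j phi_j, where the bumps phi_j have height of order q^-beta
   and live on about q^(d - alpha beta) cells of side 1/q, and sigma is a vector
   of signs.  Fix a batch starting at time n = t_i and give the learner the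
   rewards of both arms at the first n times: the observations are then i.i.d.,
   whatever the policy does.  Replacing sigma_j = 0 by +-1 changes the
   law of the reward at x by a density 1 +- 2 phi_j(x), and for q of order
   n^(1/(2 beta + d)) the two signs cannot be told apart from n observations.  Averaging over sigma, each pull before t_(i+1) costs at least a constant
   times n^-gamma, so that some sigma has regret at least a constant times
   t_(i+1) t_i^-gamma.  One batch satisfies
   t_(i+1) t_i^-gamma >= T^((1 - gamma) / (1 - gamma^M)). *)

(** * Integration against the law of independent observations *)

(** The exponents balance as follows. A bump falls continuously to 0, so inside its cell the gap
    takes all small values; the part of the cell where the gap is at most delta has relative mass of
    order at most (q delta^(1/beta))^(alpha beta). Over q^(d - alpha beta) cells of mass q^-d this
    adds up to delta^alpha whatever q is, which is why only part of the cells carry a bump. A blind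
    learner then loses q^(d - alpha beta) q^-d q^-beta = q^(-beta (1 + alpha)), and the choice of q
    turns this into n^-gamma. The two signs of a bump are compared through the product of their
    likelihood ratios against the instance without that bump. This product contains no reward, is at
    most 1 and factorizes over time, so its integral is an explicit power. The loss at time s weighs
    an error by the bump at X_s, which is independent of the n earlier observations granted to the
    learner. The grid being deterministic, the long batch, hence q and the family of bumps, can be
    fixed before the policy plays; only one batch is used, so the constant does not depend on M. *)

Section iid_law_integral.
Context {d : measure_display} {T : measurableType d} {R : realType}.
Implicit Types P Q : probability T R.

Lemma ge0_integral_iid_law0 P (F : 0.-tuple T -> \bar R) :
    measurable_fun setT F ->
  (\int[iid_law P 0]_z F z = F [tuple])%E.
Proof. by move=> mF; rewrite /= integral_dirac// diracT mul1e. Qed.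

Lemma ge0_integral_iid_lawS P n (F : n.+1.-tuple T -> \bar R) :
    measurable_fun setT F -> (forall z, 0 <= F z)%E ->
  (\int[iid_law P n.+1]_z F z =
   \int[P]_x \int[iid_law P n]_z F (cons_pair (x, z)))%E.
Proof.
move=> mF F0; rewrite /= ge0_integral_distribution// fubini_tonelli1//=.
by apply: measurableT_comp => //; exact: measurable_cons_pair.
Qed.

Lemma measurable_section_iid_law P n (F : n.+1.-tuple T -> \bar R) :
    measurable_fun setT F -> (forall z, 0 <= F z)%E ->
  measurable_fun setT (fun x => \int[iid_law P n]_z F (cons_pair (x, z)))%E.
Proof.
move=> mF F0.
apply: (@measurable_fun_fubini_tonelli_F _ _ _ _ _ (iid_law P n)
  (F \o @cons_pair _ T n)) => //=.
by apply: measurableT_comp => //; exact: measurable_cons_pair.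
Qed.

Lemma measurable_cons_pair2 n (x : T) :
  measurable_fun setT (fun z : n.-tuple T => cons_pair (x, z)).
Proof.
apply: (@measurableT_comp _ _ _ _ _ _ (@cons_pair _ T n) _ (pair x)).
  exact: measurable_cons_pair.
exact: measurable_pair1.
Qed.

(* Densities are only recorded on the first [m] coordinates: on the others [F]
   depends on the projection [p] only, whose law does not change. *)
Lemma ge0_integral_iid_law_density d' (S : measurableType d') (p : T -> S)
    P Q (g : T -> R) n m (F : n.-tuple T -> \bar R) :
    measurable_fun setT g -> (forall x, 0 <= g x) ->
    (forall f : T -> \bar R, measurable_fun setT f -> (forall x, 0 <= f x)%E ->
      \int[P]_x f x = \int[Q]_x (f x * (g x)%:E))%E ->
    (forall f : T -> \bar R, measurable_fun setT f -> (forall x, 0 <= f x)%E ->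
      (forall x y, p x = p y -> f x = f y) -> \int[P]_x f x = \int[Q]_x f x)%E ->
    measurable_fun setT F -> (forall z, 0 <= F z)%E ->
    (forall z z', (forall i : 'I_n, (i < m)%N -> tnth z i = tnth z' i) ->
      (forall i, p (tnth z i) = p (tnth z' i)) -> F z = F z') ->
  (\int[iid_law P n]_z F z =
   \int[iid_law Q n]_z (F z * (\prod_(i < n | (i < m)%N) g (tnth z i))%:E))%E.
Proof.
move=> mg g0 PQ PQp.
have mprod k l : measurable_fun setT
    (fun z : k.-tuple T => \prod_(i < k | (i < l)%N) g (tnth z i)).
  rewrite (_ : (fun _ => _) = fun z => \prod_(i < k)
      (if (i < l)%N then g (tnth z i) else 1)); last first.
    by apply/funext => z; rewrite big_mkcond.
  apply: measurable_prod => i _; case: (i < _)%N => //.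
  by apply: measurableT_comp => //; exact: measurable_tnth.
elim: n m F => [|n IH] m F mF F0 FE.
  rewrite !ge0_integral_iid_law0// ?big_ord0 ?mule1//.
  by apply: emeasurable_funM => //; apply/measurable_EFinP; exact: mprod.
rewrite ge0_integral_iid_lawS// ge0_integral_iid_lawS//; last 2 first.
- by apply: emeasurable_funM => //; apply/measurable_EFinP; exact: mprod.
- by move=> z; rewrite mule_ge0// lee_fin prodr_ge0.
have consE x (z : n.-tuple T) : tnth (cons_pair (x, z)) ord0 = x by [].
have consSE x (z : n.-tuple T) i : tnth (cons_pair (x, z)) (lift ord0 i) = tnth z i.
  by rewrite tnthS.
have mFx x : measurable_fun setT (fun z : n.-tuple T => F (cons_pair (x, z))).
  by apply: measurableT_comp => //; exact: measurable_cons_pair2.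
(* Once no density is left to record, [F] sees every coordinate only through [p], so the first one
   is exchanged by [PQp] instead of [PQ]. *)
case: m FE => [|m] FE.
  under [in RHS]eq_integral do under eq_integral do rewrite big_pred0// mule1.
  have E x : (\int[iid_law P n]_z F (cons_pair (x, z)) =
      \int[iid_law Q n]_z F (cons_pair (x, z)))%E.
    rewrite (IH 0%N)//; last first.
      move=> z z' _ zz'; apply: FE => // i.
      by case: (unliftP ord0 i) => [j|] ->; rewrite ?consE// !consSE.
    by apply: eq_integral => z _; rewrite big_pred0// mule1.
  transitivity (\int[P]_x \int[iid_law Q n]_z F (cons_pair (x, z)))%E.
    by apply: eq_integral => x _; exact: E.
  apply: PQp => [|x|x y xy].
  - exact: measurable_section_iid_law.
  - exact: integral_ge0.
  - apply: eq_integral => z _; apply: FE => // i.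
    by case: (unliftP ord0 i) => [j|] ->; rewrite ?consE// !consSE.
transitivity (\int[P]_x \int[iid_law Q n]_z
    (F (cons_pair (x, z)) * (\prod_(i < n | (i < m)%N) g (tnth z i))%:E))%E.
  apply: eq_integral => x _; rewrite (IH m)// => z z' zz' pzz'; apply: FE => i.
    by case: (unliftP ord0 i) => [j|] ->; rewrite ?consE// !consSE => /zz'.
  by case: (unliftP ord0 i) => [j|] ->; rewrite ?consE// !consSE.
rewrite PQ.
- apply: eq_integral => x _; rewrite -ge0_integralZr//=; first last.
  + by rewrite lee_fin.
  + by move=> z _; rewrite mule_ge0// lee_fin prodr_ge0.
  + by apply: emeasurable_funM => //; apply/measurable_EFinP; exact: mprod.
  apply: eq_integral => z _; rewrite -muleA -EFinM; congr (_ * _%:E)%E.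
  rewrite [RHS]big_mkcond big_ord_recl/= consE mulrC; congr (_ * _).
  by rewrite big_mkcond; apply: eq_bigr => i _; rewrite tnthS.
- pose G (z : n.+1.-tuple T) :=
    (F z * (\prod_(i < n | (i < m)%N) g (tnth z (lift ord0 i)))%:E)%E.
  rewrite [X in measurable_fun _ X](_ : _ =
      fun x => \int[iid_law Q n]_z G (cons_pair (x, z)))%E; last first.
    apply/funext => x; apply: eq_integral => z _; rewrite /G.
    by under [in RHS]eq_bigr do rewrite consSE.
  apply: measurable_section_iid_law.
    apply: emeasurable_funM => //; apply/measurable_EFinP.
    rewrite (_ : (fun _ => _) = fun z : n.+1.-tuple T => \prod_(i < n)
        (if (i < m)%N then g (tnth z (lift ord0 i)) else 1)); last first.
      by apply/funext => z; rewrite big_mkcond.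
    apply: measurable_prod => i _; case: (i < _)%N => //.
    by apply: measurableT_comp => //; exact: measurable_tnth.
  by move=> z; rewrite mule_ge0// lee_fin prodr_ge0.
- by move=> x; apply: integral_ge0 => z _; rewrite mule_ge0// lee_fin prodr_ge0.
Qed.

Lemma ge0_integral_iid_law_prod P n (f : 'I_n -> T -> R) :
    (forall i, measurable_fun setT (f i)) -> (forall i x, 0 <= f i x) ->
  (\int[iid_law P n]_z (\prod_(i < n) f i (tnth z i))%:E =
   \prod_(i < n) \int[P]_x (f i x)%:E)%E.
Proof.
have mprod k (h : 'I_k -> T -> R) : (forall i, measurable_fun setT (h i)) ->
    measurable_fun setT (fun z : k.-tuple T => (\prod_(i < k) h i (tnth z i))%:E).
  move=> mh; apply/measurable_EFinP; apply: measurable_prod => i _.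
  by apply: measurableT_comp => //; exact: measurable_tnth.
elim: n f => [|n IH] f mf f0.
  rewrite ge0_integral_iid_law0 ?big_ord0//; exact: mprod.
rewrite ge0_integral_iid_lawS; [|exact: mprod|by move=> z; rewrite lee_fin prodr_ge0].
rewrite big_ord_recl -IH// -ge0_integralZr//=.
- apply: eq_integral => x _; rewrite -ge0_integralZl//=; first last.
  + by rewrite lee_fin.
  + by move=> z _; rewrite lee_fin prodr_ge0.
  + by apply: (mprod _ (fun i => f (lift ord0 i))).
  apply: eq_integral => z _; rewrite big_ord_recl EFinM.
  by congr (_ * _%:E)%E; apply: eq_bigr => i _; rewrite tnthS.
- exact/measurable_EFinP.
- by move=> x _; rewrite lee_fin.
- by apply: integral_ge0 => z _; rewrite lee_fin prodr_ge0.
Qed.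

End iid_law_integral.

(** * Instances with one Bernoulli arm and one constant arm *)

Lemma uniform_prob01E (R : realType) (A : set (measurableTypeR R)) :
    measurable A ->
  uniform_prob (@ltr01 R) A = lebesgue_measure (A `&` `[0, 1]).
Proof.
move=> mA; rewrite /uniform_prob integral_uniform_pdf.
under eq_integral.
  move=> x /set_mem [_] /=; rewrite in_itv/= => x01.
  rewrite /uniform_pdf x01 subr0 invr1; over.
by rewrite integral_cst ?mul1e//; exact: measurableI.
Qed.

Lemma uniform_prob01_itv (R : realType) (x y : bool) (a b : R) :
    0 <= a -> a <= b -> b <= 1 ->
  uniform_prob (@ltr01 R) [set` Interval (BSide x a) (BSide y b)] = (b - a)%:E.
Proof.
move=> a0 ab b1; rewrite uniform_prob01E; last exact: measurable_itv.
have [->|anb] := eqVneq a b.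
  rewrite subrr; apply/eqP; rewrite eq_le measure_ge0 andbT.
  apply: (@le_trans _ _ (lebesgue_measure [set b])); last first.
    by rewrite lebesgue_measure_set1.
  apply: le_measure; rewrite ?inE//; first exact: measurableI.
  move=> v [/=]; rewrite in_itv/= => /andP[+ +] _.
  by move=> /lteifW bv /lteifW vb; apply/eqP; rewrite eq_le bv vb.
rewrite (_ : _ `&` _ = [set` Interval (BSide x a) (BSide y b)]).
  by rewrite lebesgue_measure_itv/= lte_fin lt_neqAle anb ab.
apply/setIidPl => v /=; rewrite !in_itv/= => /andP[/lteifW av /lteifW vb].
by rewrite (le_trans a0 av) (le_trans vb b1).
Qed.

Section bernoulli_reward.
Context {d : measure_display} {T : measurableType d} {R : realType}.
Variables (P : probability T R) (f : {mfun T >-> measurableTypeR R}).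

(* A uniform [v] below [f x] gives a reward 1, so that the reward is Bernoulli
   of parameter [f x]; the other arm always pays 1/2. *)
Definition threshold_reward (z : T * measurableTypeR R) :
    T * (measurableTypeR R * measurableTypeR R) :=
  (z.1, ((z.2 <= f z.1)%R%:R, 2^-1)).

Lemma measurable_threshold_reward : measurable_fun setT threshold_reward.
Proof.
apply: measurable_fun_pair => //; apply: measurable_fun_pair => //.
rewrite (_ : (fun _ => _) = fun z : T * measurableTypeR R =>
  if z.2 <= f z.1 then 1 else 0 : R); last first.
  by apply/funext => z; case: ifP.
apply: measurable_fun_ifT => //=.
apply: measurable_fun_ler => //.
by apply: (@measurableT_comp _ _ _ _ _ _ f).
Qed.

HB.instance Definition _ := isMeasurableFun.Build _ _ _ _
  threshold_reward measurable_threshold_reward.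

Definition bernoulli_law : probability (T * (measurableTypeR R * measurableTypeR R))%type R :=
  [the probability _ _ of distribution [the probability _ _ of
     (P \x [the probability (measurableTypeR R) R of uniform_prob (@ltr01 R)])%E]
     threshold_reward].

Lemma ge0_integral_bernoulli_law
    (F : T * (measurableTypeR R * measurableTypeR R) -> \bar R) :
    (forall x, 0 <= f x <= 1) ->
    measurable_fun setT F -> (forall z, 0 <= F z)%E ->
  (\int[bernoulli_law]_z F z = \int[P]_x
     ((f x)%:E * F (x, (1, 2^-1)%R) + (1 - f x)%:E * F (x, (0, 2^-1)%R)))%E.
Proof.
move=> f01 mF F0; rewrite ge0_integral_distribution// fubini_tonelli1//=; last first.
  by apply: measurableT_comp => //; exact: measurable_threshold_reward.
apply: eq_integral => x _; rewrite /fubini_F /threshold_reward/=.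
have [fx0 fx1] := andP (f01 x).
set U := uniform_prob _.
(* The reward is 1 exactly for [v] in [A]; the integral over [v] is split along [A] and its
   complement, on each of which the integrand is constant. *)
pose A : set (measurableTypeR R) := [set` `]-oo, f x]].
have mA : measurable A by exact: measurable_itv.
have UA : U A = (f x)%:E.
  rewrite /U uniform_prob01E// (_ : _ `&` _ = `[0, f x]%classic).
    rewrite lebesgue_measure_itv/= lte_fin; case: ltP => [_|x0].
      by rewrite oppr0 adde0.
    by congr EFin; apply/eqP; rewrite eq_le fx0 x0.
  apply/seteqP; split => v; rewrite /A/= !in_itv/=.
    by move=> [-> /andP[->]].
  by move=> /andP[-> vf]; rewrite vf (le_trans vf).
have UB : U (~` A) = (1 - f x)%:E.
  by rewrite /U probability_setC// EFinB; congr (_ - _)%E; exact: UA.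
rewrite -(setvU A) setUC ge0_integral_setU//=; last 3 first.
- exact: measurableC.
- rewrite setUC setvU; apply: (@measurableT_comp _ _ _ _ _ _ F) => //.
  apply: (@measurableT_comp _ _ _ _ _ _ threshold_reward _ (pair x)).
    exact: measurable_threshold_reward.
  exact: measurable_pair1.
- by apply/disj_setPCl.
congr (_ + _)%E.
  rewrite -[RHS]muleC -[in RHS]UA -integral_cst//; apply: eq_integral => v.
  by rewrite inE/= /A/= in_itv/= => ->.
rewrite -[RHS]muleC -[in RHS]UB -integral_cst//; last exact: measurableC.
apply: eq_integral => v.
by rewrite inE/= /A/= in_itv/= => /negP/negbTE ->.
Qed.
End bernoulli_reward.

Lemma bernoulli_law_fst {d : measure_display} {T : measurableType d} {R : realType}
    (P : probability T R) (f : {mfun T >-> measurableTypeR R}) (A : set T) :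
  measurable A -> bernoulli_law P f (fst @^-1` A) = P A.
Proof.
move=> mA; rewrite /= /distribution /pushforward.
rewrite (_ : _ @^-1` _ = A `*` setT).
  rewrite product_measure1E//= -[RHS]mule1; congr (_ * _)%E.
  exact: probability_setT.
by apply/seteqP; split => -[x v] //= [].
Qed.

Section bernoulli_instance.
Context {R : realType} {d : nat}.
Variable f : {mfun covariate R d >-> measurableTypeR R}.
Hypothesis f01 : forall x, 0 <= f x <= 1.

Definition two_armed_mean (k : bool) (x : covariate R d) : R :=
  if k then f x else 2^-1.

Definition two_armed_law : probability (observation R d) R :=
  bernoulli_law (cube_uniform R d) f.

Let two_armed_mean_measurable k : measurable_fun setT (two_armed_mean k).
Proof. by case: k; [exact: (measurable_funP f)|exact: measurable_cst]. Qed.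

Lemma measurable_reward k : measurable_fun setT (@reward R d k).
Proof.
by case: k; [apply: (measurableT_comp measurable_fst)|
  apply: (measurableT_comp measurable_snd)].
Qed.

Let two_armed_mean_ge0 k x : 0 <= two_armed_mean k x.
Proof. by case: k; rewrite /= ?invr_ge0//; case/andP: (f01 x). Qed.

Let two_armed_reward_bounded k :
  {ae two_armed_law, forall z, 0 <= reward k z <= 1}.
Proof.
have mS : measurable [set z : observation R d | 0 <= reward k z <= 1].
  rewrite [X in measurable X](_ : _ = reward k @^-1` `[0, 1]).
    by rewrite -[X in measurable X]setTI; exact: measurable_reward.
  by apply/seteqP; split => z /=; rewrite in_itv.
exists (~` [set z | 0 <= reward k z <= 1]); split => //.
  exact: measurableC.
rewrite /two_armed_law /= /distribution /pushforward.
rewrite (_ : _ @^-1` _ = set0) ?measure0//.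
apply/seteqP; split => // -[x v] H; exfalso; apply: H.
case: k {mS} => /=; last by rewrite invr_ge0 invf_le1// ler0n ler1n.
by case: (v <= f x); rewrite ?(lexx, ler01).
Qed.

Lemma ge0_integral_two_armed_law_preimage (h : observation R d -> R)
    (A : set (covariate R d)) :
    measurable A -> measurable_fun setT h -> (forall z, 0 <= h z) ->
  (\int[two_armed_law]_(z in fst @^-1` A) (h z)%:E =
   \int[cube_uniform R d]_(x in A)
     (f x * h (x, (1, 2^-1)) + (1 - f x) * h (x, (0, 2^-1)))%:E)%E.
Proof.
move=> mA mh h0.
have m1 : measurable_fun setT (\1_A : covariate R d -> R) by [].
have E (z : observation R d) :
    (((EFin \o h) \_ (fst @^-1` A)) z = (h z * \1_A z.1)%:E)%E.
  rewrite patchE indicE (_ : (z \in _) = (z.1 \in A))//.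
  by case: (z.1 \in A); rewrite ?mulr1// mulr0.
rewrite integral_mkcond; under eq_integral do rewrite E.
rewrite ge0_integral_bernoulli_law//.
- rewrite [RHS]integral_mkcond; apply: eq_integral => x _.
  rewrite patchE -!EFinM -EFinD/= indicE; case: (x \in A); last by rewrite !mulr0 addr0.
  by rewrite !mulr1.
- apply/measurable_EFinP; apply: measurable_funM => //.
  exact: (measurableT_comp m1).
- by move=> z; rewrite lee_fin mulr_ge0// indicE.
Qed.

Let two_armed_mean_law k (A : set (covariate R d)) : measurable A ->
  (\int[two_armed_law]_(z in fst @^-1` A) (reward k z)%:E =
   \int[two_armed_law]_(z in fst @^-1` A) (two_armed_mean k z.1)%:E)%E.
Proof.
move=> mA.
have mD : measurable (fst @^-1` A : set (observation R d)).
  by rewrite -[X in measurable X]setTI; exact: measurable_fst.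
rewrite [RHS](ge0_integral_two_armed_law_preimage
  (fun z => two_armed_mean k z.1))//; last first.
  exact: (measurableT_comp (two_armed_mean_measurable k)).
(* The reward is nonnegative only almost surely, whereas the integral formula asks for nonnegativity
   everywhere; the absolute value repairs this. *)
transitivity (\int[two_armed_law]_(z in fst @^-1` A) `|reward k z|%:E)%E.
  apply: ae_eq_integral => //.
  - by apply/measurable_EFinP/measurable_funTS; exact: measurable_reward.
  - apply/measurable_EFinP/measurable_funTS; apply: measurableT_comp => //.
    exact: measurable_reward.
  - apply: filterS (two_armed_reward_bounded k) => z /andP[z0 _] _.
    by rewrite ger0_norm.
rewrite (ge0_integral_two_armed_law_preimage (fun z => `|reward k z|))//.
- apply: eq_integral => x _; congr EFin.
  by case: k => /=; rewrite ?normr1 ?normr0 ?ger0_norm ?invr_ge0//; ring.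
- by apply: measurableT_comp => //; exact: measurable_reward.
Qed.

Lemma two_armed_covariate_law (A : set (covariate R d)) : measurable A ->
  covariate_law two_armed_law A = cube_uniform R d A.
Proof. by move=> mA; rewrite /covariate_law /pushforward bernoulli_law_fst. Qed.

Let two_armed_density_law : exists (c C : R) (p : covariate R d -> R),
    [/\ 0 < c, measurable_fun setT p,
        forall x, cube R d x -> c <= p x <= C &
        forall A, measurable A -> covariate_law two_armed_law A =
          (\int[cube_uniform R d]_(x in A) (p x)%:E)%E].
Proof.
exists 1, 1, (cst 1); split => // [x _|A mA]; first by rewrite lexx.
by rewrite (@integral_cst _ _ _ (cube_uniform R d) A mA 1%E) mul1e two_armed_covariate_law.
Qed.

Definition two_armed_instance : bandit_instance R d :=
  BanditInstance two_armed_mean_measurable two_armed_reward_bounded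
    two_armed_mean_law two_armed_density_law.

End bernoulli_instance.

(** * Measurability and information structure of a policy *)

Section play_theory.
Context {R : realType} {d T M : nat} {t : seq nat}.
Variable pi : batch_policy R d T M t.
Implicit Types (u : seed pi) (z : T.-tuple (observation R d)).

Lemma size_collected u z n : size (collected u z n) = n.
Proof. by elim: n => //= n IH; rewrite size_rcons IH. Qed.

Lemma nth_collected u z n l : (l < n)%N ->
  nth 0 (collected u z n) l = nth 0 (collected u z l.+1) l.
Proof.
elim: n => //= n IH; rewrite ltnS leq_eqVlt => /predU1P[->//|ln].
by rewrite nth_rcons size_collected ln IH.
Qed.

Lemma eq_arm_given u z z' ys (s : 'I_T) :
    (forall i, (tnth z i).1 = (tnth z' i).1) ->
  arm_given u z ys s = arm_given u z' ys s.
Proof.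
move=> zz'; rewrite /arm_given zz'; congr (rule _ _ _ _ _).
by apply: eq_from_tnth => i; rewrite !tnth_map zz'.
Qed.

Lemma eq_collected u z z' n :
    (forall i, (tnth z i).1 = (tnth z' i).1) ->
    (forall i : 'I_T, (i < n)%N -> tnth z i = tnth z' i) ->
  collected u z n = collected u z' n.
Proof.
move=> zz'; elim: n => //= n IH nzz'.
rewrite IH => [|i /ltnW]; last exact: nzz'.
case: insubP => // s _ sn; rewrite (eq_arm_given _ _ _ _ _ zz') nzz'//.
by rewrite sn.
Qed.

(** This removes the adaptivity of the data: whatever arms were pulled, what the policy knows in
    batch [i] is a function of the seed, the covariates and both rewards at the first t_i times.
    [rule_batched] discards the later collected rewards and [eq_collected] identifies the earlier
    ones. *)
Lemma eq_arm_pulled u z z' i (s : 'I_T) :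
    (i < M)%N -> (nth 0 t i <= s < nth 0 t i.+1)%N ->
    (forall j, (tnth z j).1 = (tnth z' j).1) ->
    (forall j : 'I_T, (j < nth 0%N t i)%N -> tnth z j = tnth z' j) ->
  arm_pulled u z s = arm_pulled u z' s.
Proof.
move=> iM its zz' izz'; rewrite /arm_pulled (eq_arm_given _ _ _ _ _ zz').
rewrite /arm_given; apply: (rule_batched iM its) => // l lti.
have [ts _] := andP its; have ls := leq_trans lti ts.
rewrite !tnth_mktuple nth_collected// [RHS]nth_collected//.
congr nth; apply: eq_collected => // j; rewrite ltnS => jl.
by apply: izz'; exact: leq_ltn_trans lti.
Qed.

Lemma measurable_arm_pulled (s : 'I_T) :
  measurable_fun setT (fun w : seed pi * T.-tuple (observation R d) =>
    arm_pulled w.1 w.2 s).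
Proof.
have mz i : measurable_fun setT
    (fun w : seed pi * T.-tuple (observation R d) => tnth w.2 i).
  apply: (@measurableT_comp _ _ _ _ _ _ (@tnth T (observation R d) ^~ i)) => //.
  exact: measurable_tnth.
have marm (ys : seed pi * T.-tuple (observation R d) -> seq R) i :
    (forall l, measurable_fun setT (fun w => nth 0 (ys w) l)) ->
    measurable_fun setT (fun w => arm_given w.1 w.2 (ys w) i).
  move=> mys; rewrite /arm_given.
  pose g (w : seed pi * T.-tuple (observation R d)) :=
    (w.1, covariates w.2,
     [tuple nth 0 (ys w) l | l < T] : T.-tuple (measurableTypeR R), (tnth w.2 i).1).
  apply: (@measurableT_comp _ _ _ _ _ _
    (fun w => rule (b:=pi) i w.1.1.1 w.1.1.2 w.1.2 w.2) _ g).
    exact: rule_measurable.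
  apply: measurable_fun_pair; last first.
    by apply: (measurableT_comp measurable_fst); exact: mz.
  apply: measurable_fun_pair; first apply: measurable_fun_pair => //.
    apply/measurable_fun_tnthP => l; rewrite /comp/=.
    under eq_fun do rewrite tnth_map.
    by apply: (measurableT_comp measurable_fst); exact: mz.
  apply/measurable_fun_tnthP => l; rewrite /comp/=.
  rewrite (_ : (fun _ => _) = fun w => nth 0 (ys w) l); first exact: mys.
  by apply/funext => w; rewrite tnth_mktuple.
suff mcol n l : measurable_fun setT
    (fun w : seed pi * T.-tuple (observation R d) =>
       nth 0 (collected w.1 w.2 n) l).
  exact: marm.
elim: n l => [|n IH] l /=.
  by under eq_fun do rewrite nth_nil; exact: measurable_cst.
under eq_fun do rewrite nth_rcons size_collected.
have [_|_|_] := ltngtP l n; [exact: IH|exact: measurable_cst|].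
case: (@insub nat (fun k => (k < T)%N) 'I_T n) => [i|]; last exact: measurable_cst.
rewrite /reward.
apply: (@measurable_fun_ifT _ _ _ _ _ _
  (fun w : seed pi * T.-tuple (observation R d) => arm_given w.1 w.2 _ i)).
- exact: marm.
- apply: (measurableT_comp measurable_fst).
  by apply: (measurableT_comp measurable_snd); exact: mz.
- apply: (measurableT_comp measurable_snd).
  by apply: (measurableT_comp measurable_snd); exact: mz.
Qed.

End play_theory.

(** * Testing the sign of one bump *)

(* AM-GM, both terms of the left-hand side being at most 1. *)
Lemma mul_le_min_add (R : realFieldType) (x y : R) : 0 <= x -> 0 <= y -> x * y <= 1 ->
  x * y <= x + 4^-1 * x + 4^-1 * y.
Proof.
move=> x0 y0 xy1; rewrite -(@ler_pXn2r _ 2)// ?nnegrE; last 2 first.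
- exact: mulr_ge0.
- by rewrite !addr_ge0// mulr_ge0// invr_ge0.
have xy0 : 0 <= x * y by exact: mulr_ge0.
have : 0 <= (x * y) * (1 - x * y) by rewrite mulr_ge0// subr_ge0.
(* After squaring, the right-hand side is ((5 x + y) / 4)^2 = (5 x - y)^2 / 16 + 5 x y / 4, and x y
   >= (x y)^2. *)
have : 0 <= (5 * x - y) ^+ 2 by exact: sqr_ge0.
nra.
Qed.

Section bernoulli_tilt.
Context {d : measure_display} {T : measurableType d} {R : realType}.
Variable P : probability T R.
Implicit Types (f : {mfun T >-> measurableTypeR R}) (h : T -> R).
Let obs : measurableType _ := (T * (measurableTypeR R * measurableTypeR R))%type.

Lemma ge0_integral_bernoulli_law_fst f (F : obs -> \bar R) (G : T -> \bar R) :
    (forall x, 0 <= f x <= 1) -> measurable_fun setT F ->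
    (forall z, 0 <= F z)%E -> (forall z, F z = G z.1) ->
  (\int[bernoulli_law P f]_z F z = \int[P]_x G x)%E.
Proof.
move=> f01 mF F0 FG; rewrite ge0_integral_bernoulli_law//.
apply: eq_integral => x _; have [fx0 fx1] := andP (f01 x).
rewrite !FG/= -ge0_muleDl ?lee_fin ?subr_ge0// -EFinD addrC subrK mul1e//.
Qed.

(* The likelihood ratio of the Bernoulli laws of parameters 1/2 + h and 1/2. *)
Definition tilt h (z : obs) : R := 1 + (if z.2.1 <= 2^-1 then -1 else 1) * (2 * h z.1).

Lemma measurable_tilt h : measurable_fun setT h -> measurable_fun setT (tilt h).
Proof.
move=> mh; apply: measurable_funD => //; apply: measurable_funM.
  apply: measurable_fun_ifT => //; apply: measurable_fun_ler => //.
  by apply: (measurableT_comp measurable_fst).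
by apply: measurable_funM => //; apply: measurableT_comp.
Qed.

Lemma tilt_ge0 h z : (forall x, `|h x| <= 2^-1) -> 0 <= tilt h z.
Proof.
move=> /(_ z.1); rewrite /tilt ler_norml => /andP[h1 h2].
by case: ifP => _; lra.
Qed.

(** The reward cancels: the product of the two opposite likelihood ratios depends on the covariate
    alone, which makes its integral computable. *)
Lemma tiltN h z : tilt h z * tilt (\- h) z = 1 - 4 * h z.1 ^+ 2.
Proof. by rewrite /tilt/=; case: ifP => _; ring. Qed.

(** Where [h] vanishes both laws give the same reward. Elsewhere the reference parameter is 1/2, and
    the ratios (1/2 + h) / (1/2) and (1/2 - h) / (1/2) for the rewards 1 and 0 are the values of
    [tilt]. *)
Lemma ge0_integral_bernoulli_law_tilt f0 f h (F : obs -> \bar R) :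
    (forall x, 0 <= f0 x <= 1) -> measurable_fun setT h ->
    (forall x, `|h x| <= 2^-1) -> (forall x, f x = f0 x + h x) ->
    (forall x, h x != 0 -> f0 x = 2^-1) ->
    measurable_fun setT F -> (forall z, 0 <= F z)%E ->
  (\int[bernoulli_law P f]_z F z = \int[bernoulli_law P f0]_z (F z * (tilt h z)%:E))%E.
Proof.
move=> f01 mh h2 fE f0E mF F0.
have f01' x : 0 <= f x <= 1.
  rewrite fE; have := h2 x; rewrite ler_norml => /andP[h2a h2b].
  have [->|/f0E ->] := eqVneq (h x) 0; first by rewrite addr0.
  by apply/andP; split; lra.
apply: (etrans (ge0_integral_bernoulli_law P f F f01' mF F0)); apply/esym.
apply: (etrans (ge0_integral_bernoulli_law P f0 _ f01 _ _)).
- apply: emeasurable_funM => //; apply/measurable_EFinP; exact: measurable_tilt.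
- by move=> z; rewrite mule_ge0// lee_fin tilt_ge0.
apply: eq_integral => x _.
have h0 : (0 <= 2^-1 :> R) = true by lra.
have h1 : (1 <= 2^-1 :> R) = false by apply/negbTE; rewrite -ltNge; lra.
rewrite /tilt/= h0 h1.
rewrite [in LHS](muleC (F _)) muleA -EFinM [in LHS](muleC (F _)) muleA -EFinM fE.
by congr (_%:E * _ + _%:E * _)%E;
  have [->|/f0E ->] := eqVneq (h x) 0; field.
Qed.

End bernoulli_tilt.

Section two_point_bound.
Context {d : measure_display} {T : measurableType d} {R : realType}.
Variable P : probability T R.
Implicit Types (f : {mfun T >-> measurableTypeR R}) (h : T -> R).
Let obs : measurableType _ := (T * (measurableTypeR R * measurableTypeR R))%type.

(** Let L+ and L- be the likelihood ratios of the first [m] observations under [f1] and [f2] with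
    respect to [f0]. Exactly one of the two errors occurs, so under [f0] the integrands on the right
    add up to at least h(X_s) min(L+, L-). By [mul_le_min_add] this minimum is at least L+ L- - (L+
    + L-) / 4. By independence h(X_s) L+ L- integrates to W k^m, and h(X_s) L+ and h(X_s) L- each
    integrate to W, whence the 1/2. *)
Lemma two_point_bound f0 f1 f2 h n m (s : 'I_n) (a : n.-tuple obs -> bool) (W k : R) :
    (forall x, 0 <= f0 x <= 1) -> measurable_fun setT h ->
    (forall x, 0 <= h x <= 4^-1) ->
    (forall x, f1 x = f0 x + h x) -> (forall x, f2 x = f0 x - h x) ->
    (forall x, h x != 0 -> f0 x = 2^-1) ->
    measurable_fun setT a -> (m <= s)%N ->
    (forall z z', (forall i : 'I_n, (i < m)%N -> tnth z i = tnth z' i) ->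
      (forall i, (tnth z i).1 = (tnth z' i).1) -> a z = a z') ->
    (\int[P]_x (h x)%:E = W%:E)%E ->
    (\int[P]_x (1 - 4 * h x ^+ 2)%:E = k%:E)%E ->
  ((W * (k ^+ m - 2^-1))%:E <=
   \int[iid_law (bernoulli_law P f1) n]_z (h (tnth z s).1 * (~~ a z)%:R)%:E +
   \int[iid_law (bernoulli_law P f2) n]_z (h (tnth z s).1 * (a z)%:R)%:E)%E.
Proof.
move=> f01 mh h01 f1E f2E f0E ma ms aE hW hk.
have h0 x : 0 <= h x by have /andP[] := h01 x.
have h4 x : h x <= 4^-1 by have /andP[] := h01 x.
have nh x : `|h x| <= 2^-1 by rewrite ger0_norm// (le_trans (h4 x))//; lra.
have nNh x : `|(\- h) x| <= 2^-1 by rewrite normrN.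
have hsq x : 0 <= 1 - 4 * h x ^+ 2 <= 1.
  by have := h0 x; have := h4 x => ? ?; apply/andP; split; nra.
have f2E' x : f2 x = f0 x + (\- h) x by exact: f2E.
have f0E' x : (\- h) x != 0 -> f0 x = 2^-1 by rewrite oppr_eq0; exact: f0E.
have mNh : measurable_fun setT (\- h) by exact: measurableT_comp.
have fb x : (0 <= f1 x <= 1) /\ (0 <= f2 x <= 1).
  have := h0 x; have := h4 x; have := f0E x; have := f01 x.
  rewrite f1E f2E; have [->|_] := eqVneq (h x) 0.
    by rewrite subr0 addr0.
  by move=> _ /(_ isT) -> ? ?; split; apply/andP; split; lra.
have mtnth i : measurable_fun setT (fun z : n.-tuple obs => tnth z i).
  exact: measurable_tnth.
have mtnth1 i : measurable_fun setT (fun z : n.-tuple obs => (tnth z i).1).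
  by apply: (measurableT_comp measurable_fst); exact: mtnth.
have mhs : measurable_fun setT (fun z : n.-tuple obs => h (tnth z s).1).
  exact: (measurableT_comp mh (mtnth1 s)).
pose L (g : T -> R) (z : n.-tuple obs) := \prod_(i < n | (i < m)%N) tilt g (tnth z i).
have mL g : measurable_fun setT g -> measurable_fun setT (L g).
  move=> mg; rewrite /L; rewrite (_ : (fun _ => _) = fun z => \prod_(i < n)
      (if (i < m)%N then tilt g (tnth z i) else 1)); last first.
    by apply/funext => z; rewrite big_mkcond.
  apply: measurable_prod => i _; case: (i < _)%N => //.
  exact: (measurableT_comp (measurable_tilt _ mg) (mtnth i)).
have L0 g z : (forall x, `|g x| <= 2^-1) -> 0 <= L g z.
  by move=> g2; apply: prodr_ge0 => i _; exact: tilt_ge0.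
have mb (b : bool) : measurable_fun setT
    (fun z : n.-tuple obs => (if b then a z else ~~ a z)%:R : R).
  rewrite (_ : (fun _ => _) = fun z : n.-tuple obs =>
      if a z then b%:R else (~~ b)%:R : R); last first.
    by apply/funext => z; case: b; case: (a z).
  exact: measurable_fun_ifT.
have law_tilt f (g : T -> R) (F : n.-tuple obs -> R) :
    measurable_fun setT g -> (forall x, `|g x| <= 2^-1) ->
    (forall x, f x = f0 x + g x) -> (forall x, g x != 0 -> f0 x = 2^-1) ->
    (forall x, 0 <= f x <= 1) ->
    measurable_fun setT F -> (forall z, 0 <= F z) ->
    (forall z z', (forall i : 'I_n, (i < m)%N -> tnth z i = tnth z' i) ->
      (forall i, (tnth z i).1 = (tnth z' i).1) -> F z = F z') ->
    (\int[iid_law (bernoulli_law P f) n]_z (F z)%:E =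
     \int[iid_law (bernoulli_law P f0) n]_z (F z * L g z)%:E)%E.
  move=> mg g2 fE g0E f01' mF F0 FE.
  apply: (etrans (ge0_integral_iid_law_density _ _
    (@fst T (measurableTypeR R * measurableTypeR R))
    (bernoulli_law P f) (bernoulli_law P f0) (tilt g) n m (EFin \o F) _ _ _ _ _ _ _)).
  - exact: measurable_tilt.
  - by move=> x; exact: tilt_ge0.
  - by move=> G mG G0; exact: ge0_integral_bernoulli_law_tilt.
  - move=> G mG G0 GE.
    transitivity (\int[P]_x G (x, (0, 0)%R))%E; [|apply/esym];
      by apply: (ge0_integral_bernoulli_law_fst P) => // z; exact: GE.
  - exact/measurable_EFinP.
  - by move=> z; rewrite lee_fin.
  - by move=> z z' zz' zz'1 /=; rewrite (FE z z').
  - by [].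
have marg f : (forall x, 0 <= f x <= 1) ->
    (\int[iid_law (bernoulli_law P f) n]_z (h (tnth z s).1)%:E = W%:E)%E.
  move=> f01'; pose F (i : 'I_n) (z : obs) := if i == s then h z.1 else 1.
  transitivity (\int[iid_law (bernoulli_law P f) n]_z
      (\prod_(i < n) F i (tnth z i))%:E)%E.
    apply: eq_integral => z _; rewrite (bigD1 s)//= /F eqxx big1 ?mulr1//.
    by move=> i /negbTE ->.
  rewrite ge0_integral_iid_law_prod; last 2 first.
  - by move=> i; rewrite /F; case: (i == s) => //; exact: measurableT_comp.
  - by move=> i z; rewrite /F; case: ifP.
  rewrite (bigD1 s)//= big1 ?mule1; last first.
    move=> i /negbTE is'; rewrite /F is' integral_cst// mul1e.
    exact: probability_setT.
  rewrite /F eqxx (ge0_integral_bernoulli_law_fst _ _ _ (EFin \o h))//.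
  - by apply/measurable_EFinP; exact: measurableT_comp.
  - by move=> z; rewrite lee_fin.
(* As [m <= s], the factor at time [s] is none of the first [m] ones, each of which contributes 1 -
   4 h^2 by [tiltN]. *)
have pairs : (\int[iid_law (bernoulli_law P f0) n]_z
    (h (tnth z s).1 * (L h z * L (\- h) z))%:E = (W * k ^+ m)%:E)%E.
  pose F (i : 'I_n) (z : obs) : R :=
    if i == s then h z.1 else if (i < m)%N then 1 - 4 * h z.1 ^+ 2 else 1.
  transitivity (\int[iid_law (bernoulli_law P f0) n]_z
      (\prod_(i < n) F i (tnth z i))%:E)%E.
    apply: eq_integral => z _; rewrite (bigD1 s)//= /F eqxx -big_split/=.
    congr (_ * _)%:E; rewrite big_mkcond [RHS]big_mkcond/=.
    apply: eq_bigr => i _; rewrite tiltN.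
    by have [->|_] := eqVneq i s; rewrite // ltnNge ms.
  have mF : measurable_fun setT (fun z : obs => 1 - 4 * h z.1 ^+ 2).
    apply: measurable_funB => //; apply: measurable_funM => //.
    by apply: measurable_funX; exact: measurableT_comp.
  rewrite ge0_integral_iid_law_prod; last 2 first.
  - move=> i; rewrite /F; case: (i == s); first exact: measurableT_comp.
    by case: (i < m)%N.
  - move=> i z; rewrite /F; case: ifP => // _; case: ifP => // _.
    by have /andP[] := hsq z.1.
  have kE i : i != s -> (\int[bernoulli_law P f0]_z (F i z)%:E =
      (if (i < m)%N then k else 1)%:E)%E.
    move=> /negbTE is'; rewrite /F is'; case: ifP => _.
      rewrite -hk (ge0_integral_bernoulli_law_fst _ _ _
        (fun x => (1 - 4 * h x ^+ 2)%:E))//.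
      - exact/measurable_EFinP.
      - by move=> z; rewrite lee_fin; have /andP[] := hsq z.1.
    by rewrite integral_cst// mul1e; exact: probability_setT.
  rewrite (bigD1 s)//= (eq_bigr _ kE) prodEFin EFinM; congr (_ * _%:E)%E.
    rewrite /F eqxx (ge0_integral_bernoulli_law_fst _ _ _ (EFin \o h))//.
    - by apply/measurable_EFinP; exact: measurableT_comp.
    - by move=> z; rewrite lee_fin.
  rewrite -big_mkcondr/= (eq_bigl (fun i : 'I_n => (i < m)%N)); last first.
    move=> i; have [->|//] := eqVneq i s; by rewrite ltnNge ms.
  have mn : (m <= n)%N by rewrite (leq_trans ms)// ltnW.
  by rewrite (big_ord_narrow mn) prodr_const card_ord.
pose b1 (z : n.-tuple obs) : R := (~~ a z)%:R.
pose b2 (z : n.-tuple obs) : R := (a z)%:R.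
have mb1 : measurable_fun setT b1 by exact: (mb false).
have mb2 : measurable_fun setT b2 by exact: (mb true).
rewrite (law_tilt f1 h (fun z => h (tnth z s).1 * b1 z))//; first last.
- by move=> z z' zz' zz'1; rewrite /b1 (aE z z')// zz'1.
- by move=> z; rewrite mulr_ge0// /b1 ler0n.
- exact: measurable_funM.
- by move=> x; case: (fb x).
rewrite (law_tilt f2 (\- h) (fun z => h (tnth z s).1 * b2 z))//; first last.
- by move=> z z' zz' zz'1; rewrite /b2 (aE z z')// zz'1.
- by move=> z; rewrite mulr_ge0// /b2 ler0n.
- exact: measurable_funM.
- by move=> x; case: (fb x).
have W1 : (\int[iid_law (bernoulli_law P f0) n]_z (h (tnth z s).1 * L h z)%:E = W%:E)%E.
  rewrite -(law_tilt f1 h (fun z => h (tnth z s).1))//.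
  - by apply: marg => x; case: (fb x).
  - by move=> x; case: (fb x).
  - by move=> z z' _ zz'1; rewrite zz'1.
have W2 : (\int[iid_law (bernoulli_law P f0) n]_z (h (tnth z s).1 * L (\- h) z)%:E = W%:E)%E.
  rewrite -(law_tilt f2 (\- h) (fun z => h (tnth z s).1))//.
  - by apply: marg => x; case: (fb x).
  - by move=> x; case: (fb x).
  - by move=> z z' _ zz'1; rewrite zz'1.
set I1 := (X in (_ <= X + _)%E); set I2 := (X in (_ <= _ + X)%E).
have LL z : 0 <= L h z * L (\- h) z <= 1.
  rewrite mulr_ge0 ?L0//= /L -big_split/=.
  by apply: prodr_ile1 => i _; rewrite tiltN hsq.
have m1 : measurable_fun setT (fun z => (h (tnth z s).1 * b1 z * L h z)%:E).
  by apply/measurable_EFinP/measurable_funM; [exact: measurable_funM|exact: mL].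
have m2 : measurable_fun setT (fun z => (h (tnth z s).1 * b2 z * L (\- h) z)%:E).
  by apply/measurable_EFinP/measurable_funM; [exact: measurable_funM|exact: mL].
have m3 : measurable_fun setT (fun z => (h (tnth z s).1 * L h z)%:E).
  by apply/measurable_EFinP/measurable_funM => //; exact: mL.
have m4 : measurable_fun setT (fun z => (h (tnth z s).1 * L (\- h) z)%:E).
  by apply/measurable_EFinP/measurable_funM => //; exact: mL.
have p1 z : (0 <= (h (tnth z s).1 * b1 z * L h z)%:E)%E.
  by rewrite lee_fin !mulr_ge0 ?L0// ler0n.
have p2 z : (0 <= (h (tnth z s).1 * b2 z * L (\- h) z)%:E)%E.
  by rewrite lee_fin !mulr_ge0 ?L0// ler0n.
have p3 z : (0 <= (h (tnth z s).1 * L h z)%:E)%E by rewrite lee_fin mulr_ge0 ?L0.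
have p4 z : (0 <= (h (tnth z s).1 * L (\- h) z)%:E)%E by rewrite lee_fin mulr_ge0 ?L0.
have q : (0 <= 4^-1 :> R)%R by rewrite invr_ge0.
have m3' : measurable_fun setT (fun z => 4^-1%:E * (h (tnth z s).1 * L h z)%:E)%E.
  exact: measurable_funeM.
have m4' : measurable_fun setT (fun z => 4^-1%:E * (h (tnth z s).1 * L (\- h) z)%:E)%E.
  exact: measurable_funeM.
have : ((W * k ^+ m)%:E <= I1 + I2 + (4^-1%:E * W%:E + 4^-1%:E * W%:E))%E.
  rewrite -pairs -{1}W1 -{1}W2 -!ge0_integralZl// /I1 /I2 -!ge0_integralD//; first last.
  - by move=> z _; rewrite mule_ge0.
  - by move=> z _; rewrite mule_ge0.
  - exact: emeasurable_funD.
  - by move=> z _; rewrite adde_ge0// mule_ge0.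
  - exact: emeasurable_funD.
  - by move=> z _; rewrite adde_ge0.
  apply: ge0_le_integral => //.
  - by move=> z _; rewrite lee_fin mulr_ge0//; have /andP[] := LL z.
  - apply/measurable_EFinP/measurable_funM => //.
    by apply: measurable_funM; exact: mL.
  - by apply: emeasurable_funD; exact: emeasurable_funD.
  move=> z _; rewrite -!EFinM -!EFinD lee_fin /b1 /b2.
  have /andP[LL0 LL1] := LL z.
  have la := L0 h z nh; have lb := L0 (\- h) z nNh.
  have hz := h0 (tnth z s).1.
  (* The error made is the one counted under [f2] if [a z] holds and under [f1] otherwise; its
     likelihood ratio plays the part of [x] in [mul_le_min_add]. *)
  case: (a z) => /=; rewrite ?(mulr1, mulr0, mul0r, addr0, add0r).
  - have := mul_le_min_add _ _ _ lb la; rewrite mulrC => /(_ LL1) H.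
    by have := ler_wpM2l hz H; lra.
  - have := mul_le_min_add _ _ _ la lb LL1 => H.
    by have := ler_wpM2l hz H; lra.
rewrite -EFinM -EFinD.
have : (0 <= I1 + I2)%E.
  by apply: adde_ge0; apply: integral_ge0 => z _; [exact: p1|exact: p2].
case: (I1 + I2)%E => [r _||].
- by rewrite -EFinD !lee_fin; lra.
- by move=> _ _; rewrite leey.
- by rewrite leeNy_eq.
Qed.
End two_point_bound.

(** * Averaging over the signs *)

Section bump_family.
Context {R : realType} {d : nat} {J : finType}.
Variable phi : J -> {mfun covariate R d >-> measurableTypeR R}.

(** The coefficients are reals rather than signs so that a bump can be switched off: the reference
    law in the test of bump [j] has coefficient 0 at [j]. *)
Definition bump_mean (c : J -> R) (x : covariate R d) : measurableTypeR R :=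
  2^-1 + \sum_j c j * phi j x.

Lemma measurable_bump_mean c : measurable_fun setT (bump_mean c).
Proof.
apply: measurable_funD => //; apply: measurable_sum => j.
by apply: measurable_funM => //; exact: (measurable_funP (phi j)).
Qed.

HB.instance Definition _ c := isMeasurableFun.Build _ _ _ _
  (bump_mean c) (measurable_bump_mean c).

Hypothesis phi4 : forall j x, 0 <= phi j x <= 4^-1.
Hypothesis phi_disj : forall i j x, phi i x != 0 -> phi j x != 0 -> i = j.

Lemma bump_sumE (g : J -> R -> R) j x : (forall i, g i 0 = 0) -> phi j x != 0 ->
  \sum_i g i (phi i x) = g j (phi j x).
Proof.
move=> g0 jx; rewrite (bigD1 j)//= big1 ?addr0// => i ij.
have [->|ix] := eqVneq (phi i x : R) 0; first exact: g0.
by rewrite (phi_disj _ _ _ ix jx) eqxx in ij.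
Qed.

Lemma bump_meanE c j x : phi j x != 0 -> bump_mean c x = 2^-1 + c j * phi j x.
Proof.
move=> jx; rewrite /bump_mean (bump_sumE (fun i y => c i * y) _ _ _ jx)// => i.
by rewrite mulr0.
Qed.

Lemma bump_mean0 c x : (forall j, phi j x = 0) -> bump_mean c x = 2^-1.
Proof. by move=> x0; rewrite /bump_mean big1 ?addr0// => j _; rewrite x0 mulr0. Qed.

Lemma bump_meanP x : (exists j, phi j x != 0) \/ (forall j, phi j x = 0).
Proof.
have [/existsP|/existsPn H] := boolP [exists j, (phi j x : R) != 0]; first by left.
by right => j; apply/eqP/negbNE/H.
Qed.

Lemma bump_mean01 c x : (forall j, `|c j| <= 1) -> 0 <= bump_mean c x <= 1.
Proof.
move=> c1; have [[j jx]|x0] := bump_meanP x; last first.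
  by rewrite bump_mean0//; apply/andP; split; lra.
rewrite (bump_meanE _ _ _ jx); have := phi4 j x; have := c1 j.
by rewrite ler_norml => /andP[? ?] /andP[? ?]; apply/andP; split; nra.
Qed.

Definition bump_sign (sigma : {ffun J -> bool}) (j : J) : R :=
  if sigma j then 1 else -1.

Lemma bump_sign_le1 sigma j : `|bump_sign sigma j| <= 1.
Proof. by rewrite /bump_sign; case: ifP; rewrite ?normrN normr1. Qed.

Definition bump_instance (sigma : {ffun J -> bool}) : bandit_instance R d :=
  two_armed_instance (bump_mean (bump_sign sigma))
    (fun x => bump_mean01 _ x (bump_sign_le1 sigma)).

(** On the support of bump [j], arm 1 is better or worse than the constant arm by [phi j] according
    to [sigma j]; off the bumps the arms tie. The regret thus splits into one testing loss per
    bump. *)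
Lemma bump_instance_gap sigma x (b : bool) :
  best_mean (bump_instance sigma) x - mean_reward (bump_instance sigma) b x =
  \sum_j phi j x * (b != sigma j)%:R.
Proof.
rewrite /best_mean /= /two_armed_mean.
have [[j jx]|x0] := bump_meanP x; last first.
  rewrite [RHS]big1 => [|j _]; last by rewrite x0 mul0r.
  by case: b => /=; rewrite !bump_mean0// maxxx subrr.
rewrite (bump_sumE (fun i y => y * (b != sigma i)%:R) _ _ _ jx); last first.
  by move=> i; rewrite mul0r.
have /andP[p0 _] := phi4 j x.
case: b => /=; rewrite !(bump_meanE _ _ _ jx) /bump_sign; case: (sigma j);
  rewrite ?mul1r ?mulN1r ?mulr0 ?mulr1.
- by rewrite max_l; lra.
- by rewrite max_r; lra.
- by rewrite max_l; lra.
- by rewrite max_r; lra.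
Qed.

Section regret_lower_bound.
Context {T M : nat} {t : seq nat}.
Variable pi : batch_policy R d T M t.
Hypothesis grid : is_grid T M t.
Let U := cube_uniform R d.
Variables (W k : J -> R).
Hypothesis phiW : forall j, (\int[U]_x (phi j x)%:E = (W j)%:E)%E.
Hypothesis phik : forall j, (\int[U]_x (1 - 4 * phi j x ^+ 2)%:E = (k j)%:E)%E.

Definition wrong_arm_loss (u : seed pi) (s : 'I_T) (j : J) sigma : \bar R :=
  (\int[iid_law (law (bump_instance sigma)) T]_z
     (phi j (tnth z s).1 * (arm_pulled u z s != sigma j)%:R)%:E)%E.

Let measurable_arm_pulled2 u s :
  measurable_fun setT (fun z : T.-tuple (observation R d) => @arm_pulled R d T M t pi u z s).
Proof.
apply: (@measurableT_comp _ _ _ _ _ _ (fun w => arm_pulled w.1 w.2 s) _ (pair u)).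
  exact: measurable_arm_pulled.
exact: measurable_pair1.
Qed.

(** A wrong pull under one sign of bump [j] is a right one under the other, so [two_point_bound]
    applies, with the observations before the batch of [s] as data. *)
Lemma wrong_arm_loss_flip u i (s : 'I_T) j (sigma sigma' : {ffun J -> bool}) :
    (i < M)%N -> (nth 0 t i <= s < nth 0 t i.+1)%N ->
    sigma j = ~~ sigma' j -> (forall j', j' != j -> sigma j' = sigma' j') ->
  ((W j * (k j ^+ nth 0%N t i - 2^-1))%:E <=
   wrong_arm_loss u s j sigma + wrong_arm_loss u s j sigma')%E.
Proof.
wlog : sigma sigma' / sigma j.
  move=> wl iM its jj' nj; have [sj|nsj] := boolP (sigma j); first exact: wl.
  rewrite addeC; apply: wl => //.
  - by move: nsj; rewrite jj' negbK.
  - by rewrite jj' negbK.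
  - by move=> j' /nj ->.
move=> sj iM its; rewrite sj => /esym/negbTE s'j nj.
(* The reference instance: bump [j] is removed and the others are kept, so that by disjointness the
   mean is 1/2 on the support of [phi j]. *)
pose c0 j' := if j' == j then 0 else bump_sign sigma j'.
have jmean c x : (forall j', j' != j -> c j' = c0 j') ->
    bump_mean c x = bump_mean c0 x + c j * phi j x.
  move=> cc0; rewrite /bump_mean (bigD1 j)//= [in RHS](bigD1 j)//= /c0 eqxx mul0r add0r.
  rewrite -addrA; congr (_ + _); rewrite addrC; congr (_ + _).
  by apply: eq_bigr => j' j'j; rewrite cc0// /c0.
have := two_point_bound U (bump_mean c0) (bump_mean (bump_sign sigma))
  (bump_mean (bump_sign sigma')) (phi j) T (nth 0%N t i) s
  (fun z => @arm_pulled R d T M t pi u z s) (W j) (k j).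
rewrite /wrong_arm_loss sj s'j /=.
under [in X in _ -> X]eq_integral do rewrite eqb_id.
under [X in _ -> (_ <= _ + X)%E]eq_integral do rewrite eqbF_neg negbK.
apply => //.
- move=> x; apply: bump_mean01 => j'; rewrite /c0; case: eqP => _.
    by rewrite normr0.
  exact: bump_sign_le1.
- exact: (measurable_funP (phi j)).
- move=> x; apply: (etrans (jmean (bump_sign sigma) x _)) => [j'|].
    by rewrite /c0 => /negbTE ->.
  by rewrite /bump_sign sj mul1r.
- move=> x; apply: (etrans (jmean (bump_sign sigma') x _)) => [j' j'j|].
    by rewrite /c0 (negbTE j'j) /bump_sign nj.
  by rewrite /bump_sign s'j mulN1r.
- by move=> x jx; rewrite /= (bump_meanE _ _ _ jx) /c0 eqxx mul0r addr0.
- by case/andP: its.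
- by move=> z z' zz' zz'1; exact: (eq_arm_pulled _ _ _ _ i).
Qed.

Let W_ge0 j : 0 <= W j.
Proof.
rewrite -lee_fin -phiW; apply: integral_ge0 => x _; rewrite lee_fin.
by case/andP: (phi4 j x).
Qed.

Lemma grid_batch i s : (s < nth 0 t i)%N -> (i <= M)%N ->
  exists2 i', (i' < i)%N & (nth 0 t i' <= s < nth 0 t i'.+1)%N.
Proof.
elim: i => [|i IH]; first by have [_ -> _ _] := grid.
move=> si iM; have [tis|sti] := leqP (nth 0%N t i) s.
  by exists i => //; rewrite tis si.
by have [i' i'i H] := IH sti (ltnW iM); exists i' => //; exact: ltnW.
Qed.

Lemma grid_nondecreasing i j : (i <= j)%N -> (j <= M)%N ->
  (nth 0 t i <= nth 0 t j)%N.
Proof.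
have [st _ _ tsort] := grid; move=> ij jM.
apply: (@sorted_leq_nth _ leq leq_trans leqnn) => //; rewrite ?inE ?st//.
  by apply: sub_sorted tsort => a b; exact: ltnW.
by rewrite ltnS (leq_trans ij).
Qed.

Hypothesis k1 : forall j, k j <= 1.

(** Flipping the sign of bump [j] is an involution, and each pair loses at least (3/4 - 1/2) W j.
    Summing over all [sigma] counts every pair twice, which turns 1/4 into 1/8. If [s] lies in an
    earlier batch, fewer rewards are known and the power of [k j] is only larger. *)
Lemma sum_wrong_arm_loss u i (s : 'I_T) j :
    (i < M)%N -> (s < nth 0 t i.+1)%N -> 0 <= k j ->
    3 / 4 <= k j ^+ nth 0%N t i ->
  ((#|{ffun J -> bool}|%:R * (W j / 8))%:E <=
   \sum_(sigma : {ffun J -> bool}) wrong_arm_loss u s j sigma)%E.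
Proof.
move=> iM sti kj0 kj.
have [i' i'i /[dup] its /andP[_ _]] := grid_batch _ _ sti iM.
have i'M : (i' < M)%N by exact: leq_trans i'i _.
have ki' : 3 / 4 <= k j ^+ nth 0%N t i'.
  rewrite (le_trans kj)// ler_wiXn2l ?k1//.
  by apply: grid_nondecreasing => //; exact: ltnW.
pose flip (sigma : {ffun J -> bool}) := [ffun j' => if j' == j then ~~ sigma j' else sigma j'].
have flipK : involutive flip.
  by move=> sigma; apply/ffunP => j'; rewrite !ffunE; case: eqP => // _; rewrite negbK.
have pair sigma : ((W j / 4)%:E <=
    wrong_arm_loss u s j sigma + wrong_arm_loss u s j (flip sigma))%E.
  apply: (@le_trans _ _ (W j * (k j ^+ nth 0%N t i' - 2^-1))%:E); last first.
    apply: (wrong_arm_loss_flip u i') => //.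
      by rewrite ffunE eqxx negbK.
    by move=> j' /negbTE j'j; rewrite ffunE j'j.
  by rewrite lee_fin; apply: ler_wpM2l => //; lra.
have loss0 sigma : (0 <= wrong_arm_loss u s j sigma)%E.
  apply: integral_ge0 => z _; rewrite lee_fin mulr_ge0//.
  by case/andP: (phi4 j (tnth z s).1).
set S := (\sum_(sigma : _) _)%E.
have : ((#|{ffun J -> bool}|%:R * (W j / 4))%:E <= S + S)%E.
  have {2}-> : S = (\sum_(sigma : {ffun J -> bool}) wrong_arm_loss u s j (flip sigma))%E.
    by rewrite /S (reindex_inj (inv_inj flipK)).
  rewrite /S -big_split/=.
  apply: (@le_trans _ _ (\sum_(sigma : {ffun J -> bool}) (W j / 4)%:E)%E).
    by rewrite sumEFin lee_fin sumr_const mulr_natl.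
  by apply: lee_sum => sigma _; exact: pair.
have : (0 <= S)%E by exact: sume_ge0.
case: S => [r _||].
- by rewrite -EFinD !lee_fin; lra.
- by move=> _ _; rewrite leey.
- by rewrite leeNy_eq.
Qed.

Let measurable_loss s j (sigma : {ffun J -> bool}) : measurable_fun setT
  (fun w : seed pi * T.-tuple (observation R d) =>
     phi j (tnth w.2 s).1 * (arm_pulled w.1 w.2 s != sigma j)%:R).
Proof.
apply: measurable_funM.
  apply: (measurableT_comp (measurable_funP (phi j))).
  apply: (measurableT_comp measurable_fst).
  apply: (@measurableT_comp _ _ _ _ _ _ (@tnth T (observation R d) ^~ s)) => //.
  exact: measurable_tnth.
rewrite (_ : (fun _ => _) = fun w : seed pi * T.-tuple (observation R d) =>
    if arm_pulled w.1 w.2 s then (true != sigma j)%:R else (false != sigma j)%:R); last first.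
  by apply/funext => w; case: (arm_pulled _ _ _).
by apply: measurable_fun_ifT => //; exact: measurable_arm_pulled.
Qed.

Lemma realized_regret_bump_instance sigma u z :
  realized_regret (bump_instance sigma) pi (u, z) =
  \sum_s \sum_j phi j (tnth z s).1 * (arm_pulled u z s != sigma j)%:R.
Proof. by apply: eq_bigr => s _; rewrite bump_instance_gap. Qed.

Lemma measurable_realized_regret_bump sigma :
  measurable_fun setT (EFin \o realized_regret (bump_instance sigma) pi).
Proof.
apply/measurable_EFinP; rewrite (_ : realized_regret _ _ = fun w =>
  \sum_s \sum_j phi j (tnth w.2 s).1 * (arm_pulled w.1 w.2 s != sigma j)%:R).
  by apply: measurable_sum => s; apply: measurable_sum => j.
by apply/funext => -[u z]; exact: realized_regret_bump_instance.
Qed.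

Lemma realized_regret_bump_ge0 sigma w :
  0 <= realized_regret (bump_instance sigma) pi w.
Proof.
case: w => u z; rewrite realized_regret_bump_instance.
apply: sumr_ge0 => s _; apply: sumr_ge0 => j _; rewrite mulr_ge0//.
by case/andP: (phi4 j (tnth z s).1).
Qed.

Lemma integral_realized_regret_bump sigma u :
  (\int[iid_law (law (bump_instance sigma)) T]_z
     (realized_regret (bump_instance sigma) pi (u, z))%:E =
   \sum_s \sum_j wrong_arm_loss u s j sigma)%E.
Proof.
have mloss s j : measurable_fun setT (fun z : T.-tuple (observation R d) =>
    (phi j (tnth z s).1 * (@arm_pulled R d T M t pi u z s != sigma j)%:R)%:E).
  apply/measurable_EFinP.
  apply: (@measurableT_comp _ _ _ _ _ _ _ _ (pair u) (measurable_loss s j sigma)).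
  exact: measurable_pair1.
have loss0 s j (z : T.-tuple (observation R d)) :
    (0 <= (phi j (tnth z s).1 * (@arm_pulled R d T M t pi u z s != sigma j)%:R)%:E)%E.
  by rewrite lee_fin mulr_ge0//; case/andP: (phi4 j (tnth z s).1).
transitivity (\int[iid_law (law (bump_instance sigma)) T]_z
    \sum_s \sum_j (phi j (tnth z s).1 * (arm_pulled u z s != sigma j)%:R)%:E)%E.
  apply: eq_integral => z _; rewrite realized_regret_bump_instance -sumEFin.
  by apply: eq_bigr => s _; rewrite -sumEFin.
rewrite ge0_integral_sum//; last 2 first.
- by move=> s; exact: emeasurable_sum.
- by move=> s z _; exact: sume_ge0.
by apply: eq_bigr => s _; rewrite ge0_integral_sum.
Qed.

Lemma exists_bump_instance i : (i < M)%N -> (forall j, 0 <= k j) ->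
    (forall j, 3 / 4 <= k j ^+ nth 0%N t i) ->
  exists sigma, (((nth 0 t i.+1)%:R * ((\sum_j W j) / 8))%:E <=
    regret (bump_instance sigma) pi)%E.
Proof.
move=> iM k0 kt; set c := _ * _.
pose G sigma u := (\int[iid_law (law (bump_instance sigma)) T]_z
     (realized_regret (bump_instance sigma) pi (u, z))%:E)%E.
have mG sigma : measurable_fun setT (G sigma).
  apply: (@measurable_fun_fubini_tonelli_F _ _ _ _ _ _
    (EFin \o realized_regret (bump_instance sigma) pi)).
    exact: measurable_realized_regret_bump.
  by move=> w; rewrite lee_fin realized_regret_bump_ge0.
have G0 sigma u : (0 <= G sigma u)%E.
  by apply: integral_ge0 => z _; rewrite lee_fin realized_regret_bump_ge0.
have rG sigma : regret (bump_instance sigma) pi = (\int[seed_law pi]_u G sigma u)%E.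
  rewrite /regret unlock fubini_tonelli1//.
  - exact: measurable_realized_regret_bump.
  - by move=> w; rewrite lee_fin realized_regret_bump_ge0.
pose N := #|{ffun J -> bool}|.
(* The bound holds for every value of the seed, so randomization does not help. Times from t_(i+1)
   on are dropped, their losses being nonnegative. *)
have NG u : ((N%:R * c)%:E <= \sum_(sigma : {ffun J -> bool}) G sigma u)%E.
  under eq_bigr do rewrite /G integral_realized_regret_bump.
  rewrite exchange_big/= [leRHS](bigID (fun s : 'I_T => (s < nth 0%N t i.+1)%N))/=.
  apply: (@le_trans _ _ (\sum_(s < T | (s < nth 0 t i.+1)%N)
      (N%:R * ((\sum_j W j) / 8))%:E)%E).
    rewrite sumEFin lee_fin /c mulrCA.
    have tT : (nth 0 t i.+1 <= T)%N.
      by have [_ _ <- _] := grid; exact: grid_nondecreasing.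
    by rewrite (big_ord_narrow tT) sumr_const card_ord -[leRHS]mulr_natl.
  rewrite -[leLHS]adde0; apply: leeD; last first.
    apply: sume_ge0 => s _; apply: sume_ge0 => sigma _; apply: sume_ge0 => j _.
    apply: integral_ge0 => z _; rewrite lee_fin mulr_ge0//.
    by case/andP: (phi4 j (tnth z s).1).
  apply: lee_sum => s st; rewrite exchange_big/= mulr_suml mulr_sumr -sumEFin.
  by apply: lee_sum => j _; exact: (sum_wrong_arm_loss _ i).
(* Arguing by contradiction makes every regret finite, so that the average can be compared with [c]
   in the reals. *)
apply/not_existsP => /= rc.
have {}rc sigma : (regret (bump_instance sigma) pi < c%:E)%E.
  by rewrite ltNge; apply/negP/rc.
have r0 sigma : (0 <= regret (bump_instance sigma) pi)%E.
  by rewrite rG; apply: integral_ge0 => u _; exact: G0.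
have rfin sigma : regret (bump_instance sigma) pi \is a fin_num.
  by rewrite ge0_fin_numE// (lt_trans (rc sigma))// ltry.
have : ((N%:R * c)%:E <= \sum_(sigma : {ffun J -> bool}) regret (bump_instance sigma) pi)%E.
  under eq_bigr do rewrite rG.
  rewrite -ge0_integral_sum//.
  rewrite -[leLHS]mule1 -(probability_setT (seed_law pi)) -integral_cst//.
  apply: ge0_le_integral => //.
  - move=> u _; rewrite lee_fin mulr_ge0// /c mulr_ge0// divr_ge0//.
    by apply: sumr_ge0.
  - exact: emeasurable_sum.
under eq_bigr do rewrite -(fineK (rfin _)).
rewrite sumEFin lee_fin leNgt => /negP; apply.
apply: (@lt_le_trans _ _ (\sum_(sigma : {ffun J -> bool}) c)); last first.
  by rewrite sumr_const mulr_natl.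
apply: ltr_sum.
  by apply/hasP; exists [ffun=> true].
by move=> sigma _; rewrite -lte_fin fineK.
Qed.

End regret_lower_bound.
End bump_family.

(** * Bumps on the cells of a regular partition of the cube *)

(** The ratios x / (x + y) and y / (x + y) are at most 1, hence at most their own powers of exponent
    [b], and they add up to 1. *)
Lemma powR_subadditive (R : realType) (b x y : R) : 0 <= b <= 1 -> 0 <= x -> 0 <= y ->
  (x + y) `^ b <= x `^ b + y `^ b.
Proof.
move=> /andP[b0 b1] x0 y0.
have [->|xn0] := eqVneq x 0; first by rewrite add0r lerDr powR_ge0.
have [->|yn0] := eqVneq y 0; first by rewrite addr0 lerDl powR_ge0.
have xgt0 : 0 < x by rewrite lt_neqAle eq_sym xn0.
have ygt0 : 0 < y by rewrite lt_neqAle eq_sym yn0.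
have s0 : 0 < x + y by exact: addr_gt0.
have part u : 0 < u -> u <= x + y -> u / (x + y) * (x + y) `^ b <= u `^ b.
  move=> u0 us.
  have -> : u `^ b = (u / (x + y)) `^ b * (x + y) `^ b.
    by rewrite -powRM ?divfK ?gt_eqF// ?divr_ge0// ltW.
  rewrite ler_wpM2r ?powR_ge0// ger1_powR// divr_gt0//= ler_pdivrMr// mul1r//.
have := part x xgt0; have := part y ygt0.
rewrite lerDl lerDr (ltW xgt0) (ltW ygt0) => /(_ isT) h1 /(_ isT) h2.
have := lerD h2 h1; rewrite -mulrDl -mulrDl divff ?gt_eqF// mul1r.
exact.
Qed.

Lemma dist_powR_le (R : realType) (b x y : R) : 0 <= b <= 1 -> 0 <= x -> 0 <= y ->
  `|x `^ b - y `^ b| <= `|x - y| `^ b.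
Proof.
move=> b01; wlog xy : x y / y <= x.
  move=> wl x0 y0; have [yx|/ltW xy] := leP y x; first exact: wl.
  by rewrite distrC (distrC x); exact: wl.
move=> x0 y0; have /andP[b0 _] := b01.
rewrite !ger0_norm ?subr_ge0//; last by rewrite ge0_ler_powR ?nnegrE.
by rewrite lerBlDr -[in leLHS](subrK y x) powR_subadditive ?subr_ge0.
Qed.

Lemma coord_le_l2_dist (R : realType) d (x y : covariate R d) i :
  `|tnth x i - tnth y i| <= l2_dist x y.
Proof.
rewrite -sqrtr_sqr ler_wsqrtr// (bigD1 i)//= lerDl.
by apply: sumr_ge0 => j _; exact: sqr_ge0.
Qed.

Section cell_bump.
Context {R : realType} {d q : nat}.
Implicit Types (j : {ffun 'I_d -> 'I_q}) (x y : covariate R d).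

Definition cell_center j i : R := ((j i)%:R + 2^-1) / q%:R.

(** The sup norm has boxes as balls, whose mass under the product law is explicit, and it is bounded
    by the Euclidean norm of the smoothness condition. *)
Definition cell_dist j x : R := \big[Num.max/0]_i `|tnth x i - cell_center j i|.

Lemma cell_dist_ge0 j x : 0 <= cell_dist j x.
Proof. exact: bigmax_ge_id. Qed.

Lemma cell_dist_ltP j x r : 0 < r ->
  reflect (forall i, `|tnth x i - cell_center j i| < r) (cell_dist j x < r).
Proof.
move=> r0; apply: (iffP (bigmax_ltP _ _ _ _)) => [[_ h] i|h]; first exact: h.
by split => // i _; exact: h.
Qed.

Lemma measurable_cell_dist j : measurable_fun setT (cell_dist j).
Proof.
rewrite /cell_dist; elim: (index_enum _) => [|i s IH].
  by under eq_fun do rewrite big_nil; exact: measurable_cst.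
under eq_fun do rewrite big_cons.
apply: measurable_maxr => //; apply: measurableT_comp => //.
by apply: measurable_funB => //; exact: measurable_tnth.
Qed.

Lemma cell_dist_lip j x y : `|cell_dist j x - cell_dist j y| <= l2_dist x y.
Proof.
suff H x' y' : cell_dist j x' - cell_dist j y' <= l2_dist x' y'.
  rewrite ler_norml H andbT lerNl opprB.
  rewrite (_ : l2_dist x y = l2_dist y x)//.
  by congr Num.sqrt; apply: eq_bigr => i _; rewrite -sqrrN opprB.
rewrite lerBlDr; apply: bigmax_le => [|i _].
  by rewrite addr_ge0 ?cell_dist_ge0// sqrtr_ge0.
rewrite -(subrK (tnth y' i) (tnth x' i)) -addrA (le_trans (ler_normD _ _))//.
by rewrite lerD ?coord_le_l2_dist//; exact: le_bigmax.
Qed.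

Variables (beta c : R).
Hypotheses (beta01 : 0 < beta <= 1) (c0 : 0 < c) (q0 : (0 < q)%N).

(** Up to [c], this is the power [beta] of the sup-norm distance from [x] to the complement of the
    cell of side 1/q around the center. *)
Definition cell_bump j x : measurableTypeR R :=
  c * (Num.max 0 ((2 * q%:R)^-1 - cell_dist j x)) `^ beta.

Lemma measurable_cell_bump j : measurable_fun setT (cell_bump j).
Proof.
apply: measurable_funM => //.
apply: (@measurableT_comp _ _ _ _ _ _ (fun y : R => y `^ beta)).
  exact: measurable_powR.
apply: measurable_maxr => //; apply: measurable_funB => //.
exact: measurable_cell_dist.
Qed.

HB.instance Definition _ j := isMeasurableFun.Build _ _ _ _
  (cell_bump j) (measurable_cell_bump j).

Let q_gt0 : 0 < q%:R :> R. Proof. by rewrite ltr0n. Qed.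

Let r0 : 0 < (2 * q%:R)^-1 :> R. Proof. by rewrite invr_gt0 mulr_gt0. Qed.

Lemma cell_bump_ge0 j x : 0 <= cell_bump j x.
Proof. by rewrite mulr_ge0 ?powR_ge0// ltW. Qed.

Lemma cell_bump_neq0 j x : (cell_bump j x != 0) = (cell_dist j x < (2 * q%:R)^-1).
Proof.
have /andP[b0 _] := beta01.
rewrite mulf_eq0 gt_eqF//= powR_eq0 (gt_eqF b0) andbT.
by rewrite /Num.max subr_gt0; case: ltP => // h; rewrite ?eqxx// gt_eqF ?subr_gt0.
Qed.

Lemma cell_bump_le j x : cell_bump j x <= c * (2 * q%:R)^-1 `^ beta.
Proof.
have /andP[/ltW b0 _] := beta01.
rewrite ler_pM2l// ge0_ler_powR// ?nnegrE ?le_max ?lexx// ?(ltW r0)//.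
by rewrite ge_max (ltW r0) lerBlDr lerDl cell_dist_ge0.
Qed.

Lemma cell_bump_lb j x r : cell_dist j x < (2 * q%:R)^-1 - r -> 0 <= r ->
  c * r `^ beta <= cell_bump j x.
Proof.
have /andP[/ltW b0 _] := beta01 => xr r_ge0.
rewrite ler_pM2l// ge0_ler_powR// ?nnegrE ?le_max ?lexx//.
by rewrite lerBrDl -lerBrDr (ltW xr) orbT.
Qed.

(** Both centers are within 1/(2q) of [x] in each coordinate, hence less than 1/q apart, while their
    coordinates differ by integer multiples of 1/q. *)
Lemma cell_bump_disj i j x : cell_bump i x != 0 -> cell_bump j x != 0 -> i = j.
Proof.
rewrite !cell_bump_neq0 => /cell_dist_ltP - /(_ r0) hi /cell_dist_ltP - /(_ r0) hj.
apply/ffunP => a; apply/val_inj => /=.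
have : `|cell_center i a - cell_center j a| < q%:R^-1.
  rewrite -(subrK (tnth x a) (cell_center i a)) -addrA (le_lt_trans (ler_normD _ _))//.
  rewrite distrC (_ : q%:R^-1 = (2 * q%:R)^-1 + (2 * q%:R)^-1).
    by rewrite ltrD.
  by field; rewrite gt_eqF.
rewrite /cell_center -mulrBl opprD addrACA subrr addr0 normrM normfV normr_nat.
rewrite -[ltRHS]mul1r ltr_pM2r ?invr_gt0// ltr_norml => /andP[h1 h2].
have {}h1 : (j a < (i a).+1)%N by rewrite -(ltr_nat R) -natr1; lra.
have {}h2 : (i a < (j a).+1)%N by rewrite -(ltr_nat R) -natr1; lra.
by apply/eqP; rewrite eqn_leq -ltnS h2 -ltnS h1.
Qed.

(** [cell_dist] is 1-Lipschitz, truncation at 0 does not increase distances, and the power [beta] is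
    Holder with constant 1. *)
Lemma cell_bump_holder j x y :
  `|cell_bump j x - cell_bump j y| <= c * l2_dist x y `^ beta.
Proof.
have /andP[b0 b1] := beta01.
rewrite -mulrBr normrM gtr0_norm// ler_pM2l//.
apply: (le_trans (dist_powR_le _ _ _ _ _ _ _)); rewrite ?(ltW b0) ?b1 ?le_max ?lexx//.
rewrite ge0_ler_powR ?(ltW b0) ?nnegrE ?sqrtr_ge0//.
apply: le_trans (cell_dist_lip j x y).
rewrite /Num.max !subr_gt0; case: ltP => h1; case: ltP => h2.
- by rewrite opprB addrC addrA subrK distrC.
- rewrite subr0 ger0_norm ?subr_ge0 ?(ltW h1)// distrC (le_trans _ (ler_norm _))//.
  by rewrite lerD2r.
- rewrite sub0r normrN ger0_norm ?subr_ge0 ?(ltW h2)// (le_trans _ (ler_norm _))//.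
  by rewrite lerD2r.
- by rewrite subrr normr0.
Qed.

Definition cell_box j (r : R) : set (covariate R d) :=
  [set x | forall i, `](cell_center j i - r), (cell_center j i + r)[%classic (tnth x i)].

Lemma cell_boxE j r : 0 < r -> cell_box j r = [set x | cell_dist j x < r].
Proof.
move=> r_gt0; apply/seteqP; split => x /=.
  move=> h; apply/cell_dist_ltP => // i; have := h i.
  by rewrite /= in_itv/= ltr_distl.
by move=> /cell_dist_ltP -/(_ r_gt0) h i; rewrite /= in_itv/= -ltr_distl.
Qed.

Lemma measurable_cell_box j r : measurable (cell_box j r).
Proof.
rewrite [X in measurable X](_ : _ = \bigcap_(i in [set: 'I_d])
    ((fun x : covariate R d => tnth x i) @^-1`
     `](cell_center j i - r), (cell_center j i + r)[)).
  apply: fin_bigcap_measurable => // i _.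
  by rewrite -[X in measurable X]setTI; apply: measurable_tnth => //; exact: measurable_itv.
by apply/seteqP; split => x /=; [move=> h i _; exact: h|move=> h i; exact: (h i)].
Qed.

(** A radius up to half the side of a cell keeps the box inside the cube, so that every side has
    uniform mass 2 r. *)
Lemma cube_uniform_cell_box j r : 0 <= r <= (2 * q%:R)^-1 ->
  cube_uniform R d (cell_box j r) = ((2 * r) ^+ d)%:E.
Proof.
move=> /andP[r_ge0 rq];
have := @iid_law_box _ _ R [the probability (measurableTypeR R) R of uniform_prob (@ltr01 R)] d
  (fun i => `](cell_center j i - r), (cell_center j i + r)[%classic).
move=> /(_ (fun i => measurable_itv _)) /= E.
rewrite /cube_uniform /cell_box E.
rewrite (eq_bigr (fun=> (2 * r)%:E)) ?prodEFin ?prodr_const ?card_ord// => i _.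
have jq : (j i)%:R + 1 <= q%:R :> R by rewrite natr1 ler_nat ltn_ord.
have j0 : 0 <= (j i)%:R :> R by exact: ler0n.
have rE : (2 * q%:R)^-1 = 2^-1 / q%:R :> R by rewrite invfM.
have lo : r <= cell_center j i.
  by rewrite (le_trans rq)// rE ler_pM2r ?invr_gt0// lerDr.
rewrite uniform_prob01_itv.
- by congr EFin; ring.
- by rewrite subr_ge0.
- by lra.
- apply: (@le_trans _ _ (cell_center j i + 2^-1 / q%:R)); first by rewrite lerD2l -rE.
  by rewrite -mulrDl ler_pdivrMr// mul1r; lra.
Qed.

End cell_bump.

(** * Membership of the bump instances in the smoothness and margin class *)

Section bump_class.
Context {R : realType} {d : nat} {J : finType}.
Variable phi : J -> {mfun covariate R d >-> measurableTypeR R}.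
Hypothesis phi4 : forall j x, 0 <= phi j x <= 4^-1.
Hypothesis phi_disj : forall i j x, phi i x != 0 -> phi j x != 0 -> i = j.
Let I := bump_instance phi phi4 phi_disj.

Lemma bump_instance_uniform sigma : uniform_covariates (I sigma).
Proof. by move=> A mA; exact: two_armed_covariate_law. Qed.

(** The two points may lie on different bumps with opposite signs. Each bump then vanishes at the
    other point and contributes its own increment; allowing L / 2 to each bump covers this case. *)
Lemma bump_instance_smooth (beta L : R) sigma : 0 <= L ->
    (forall j x y, `|phi j x - phi j y| <= L / 2 * l2_dist x y `^ beta) ->
  smooth beta L (I sigma).
Proof.
move=> L0 phiL k x y _ _.
case: k; last by rewrite /= subrr normr0 mulr_ge0// powR_ge0.
have s1 j : `|bump_sign (R := R) sigma j| = 1.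
  by rewrite /bump_sign; case: ifP; rewrite ?normrN normr1.
have sP j u : `|bump_sign sigma j * u| = `|u| :> R by rewrite normrM s1 mul1r.
have l0 : 0 <= L / 2 * l2_dist x y `^ beta.
  by rewrite mulr_ge0 ?powR_ge0// divr_ge0.
have active j u v : `|phi j u - phi j v| <= L / 2 * l2_dist x y `^ beta ->
    phi j v = 0 -> `|phi j u| <= L / 2 * l2_dist x y `^ beta.
  by move=> + v0; rewrite v0 subr0.
have phiL' j u v : u = x -> v = y ->
    `|phi j v - phi j u| <= L / 2 * l2_dist x y `^ beta.
  by move=> -> ->; rewrite distrC.
rewrite /= /two_armed_mean.
rewrite [leRHS](_ : _ = L / 2 * l2_dist x y `^ beta + L / 2 * l2_dist x y `^ beta); last first.
  by rewrite -mulrDl -splitr.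
have [[i ix]|x0] := bump_meanP phi x; have [[j jy]|y0] := bump_meanP phi y.
- rewrite (bump_meanE phi phi_disj _ _ _ ix) (bump_meanE phi phi_disj _ _ _ jy).
  rewrite opprD addrACA subrr add0r.
  have [ij|ij] := eqVneq i j.
    rewrite -ij -mulrBr sP (le_trans (phiL i x y))// lerDl//.
  have iy : phi i y = 0.
    apply/eqP/negP => /negP iy; move: ij.
    by rewrite (phi_disj _ _ _ iy jy) eqxx.
  have jx : phi j x = 0.
    apply/eqP/negP => /negP jx; move: ij.
    by rewrite (phi_disj _ _ _ ix jx) eqxx.
  rewrite (le_trans (ler_normB _ _))// !sP lerD//.
    exact: (active i x y).
  by apply: (active j y x) => //; exact: phiL'.
- rewrite (bump_meanE phi phi_disj _ _ _ ix) (bump_mean0 _ _ _ y0).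
  rewrite addrAC subrr add0r sP (le_trans (active i x y _ _))// ?lerDl//.
- rewrite (bump_meanE phi phi_disj _ _ _ jy) (bump_mean0 _ _ _ x0).
  rewrite opprD addrA subrr add0r normrN sP (le_trans (active j y x _ _))// ?lerDl//.
  exact: phiL'.
- by rewrite !bump_mean0// subrr normr0 addr_ge0.
Qed.

(** On bump [j] the gap between the arms is [phi j] whatever the sign, so a union bound over the
    bumps suffices. *)
Lemma bump_instance_margin (alpha D0 delta0 : R) (p : R -> R) sigma :
    (forall delta j, 0 <= delta ->
      (cube_uniform R d [set x | (0 < phi j x <= delta)%R] <= (p delta)%:E)%E) ->
    (forall delta, 0 <= delta -> #|J|%:R * p delta <= D0 * delta `^ alpha) ->
  margin alpha D0 delta0 (I sigma).
Proof.
move=> phip pD delta /andP[delta_ge0 _].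
have mS j : measurable [set x | 0 < phi j x <= delta].
  rewrite [X in measurable X](_ : _ = phi j @^-1` [set` `]0, delta]]).
    by rewrite -[X in measurable X]setTI; apply: (measurable_funP (phi j)).
  by apply/seteqP; split => x /=; rewrite in_itv.
have gapE : [set x | 0 < `|mean_reward (I sigma) true x -
      mean_reward (I sigma) false x| <= delta]
    = \big[setU/set0]_j [set x | 0 < phi j x <= delta].
  apply/seteqP; split => x.
    rewrite /= /two_armed_mean/=.
    have [[j jx]|x0] := bump_meanP phi x; last first.
      by rewrite bump_mean0// subrr normr0 ltxx.
    rewrite (bump_meanE phi phi_disj _ _ _ jx) addrC addKr normrM.
    rewrite (_ : `|bump_sign _ _| = 1); last first.
      by rewrite /bump_sign; case: ifP; rewrite ?normrN normr1.
    rewrite mul1r ger0_norm; last by case/andP: (phi4 j x).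
    by move=> H; rewrite -bigcup_seq; exists j => //=; exact: mem_index_enum.
  rewrite -bigcup_seq => -[j _] /= /andP[jx jd].
  have jx0 : phi j x != 0 by rewrite gt_eqF.
  rewrite /two_armed_mean/= (bump_meanE phi phi_disj _ _ _ jx0) addrC addKr normrM.
  rewrite (_ : `|bump_sign _ _| = 1); last first.
    by rewrite /bump_sign; case: ifP; rewrite ?normrN normr1.
  by rewrite mul1r gtr0_norm// jx.
rewrite [leLHS](_ : _ = cube_uniform R d
  (\big[setU/set0]_j [set x | 0 < phi j x <= delta])); last first.
  rewrite gapE; apply: bump_instance_uniform.
  by apply: bigsetU_measurable => j _.
pose S j : set (covariate R d) := [set x | 0 < phi j x <= delta].
rewrite -/(S _); apply: (@le_trans _ _ (\sum_j cube_uniform R d (S j))%E).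
  elim: (index_enum J) => [|j s IH]; first by rewrite !big_nil measure0.
  rewrite !big_cons; apply: le_trans (measureU2 _ (mS j) _) _.
    by apply: bigsetU_measurable => i _; exact: mS.
  by rewrite leeD2l.
apply: (@le_trans _ _ (\sum_(j : J) (p delta)%:E)%E).
  by apply: lee_sum => j _; exact: phip.
by rewrite sumEFin lee_fin sumr_const -mulr_natl pD.
Qed.

End bump_class.

Lemma bernoulli_inequality (R : realType) (x : R) n : 0 <= x <= 1 ->
  1 - n%:R * x <= (1 - x) ^+ n.
Proof.
move=> /andP[x0 x1]; elim: n => [|n IH]; first by rewrite mul0r subr0 expr0.
rewrite exprS -natr1; apply: (@le_trans _ _ ((1 - x) * (1 - n%:R * x))).
  have : 0 <= n%:R * (x * x) by rewrite mulr_ge0// mulr_ge0.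
  by lra.
by rewrite ler_wpM2l// subr_ge0.
Qed.

(** * Mass, information and margin of a single bump under the uniform law *)

Section cell_bump_law.
Context {R : realType} {d q : nat} (beta c : R).
Hypotheses (beta01 : 0 < beta <= 1) (c0 : 0 < c) (c4 : c <= 4^-1).
Hypotheses (q0 : (0 < q)%N) (d0 : (0 < d)%N).
Let U := cube_uniform R d.
Let phi (j : {ffun 'I_d -> 'I_q}) : {mfun covariate R d >-> measurableTypeR R} :=
  cell_bump beta c j.

Let q_gt0 : 0 < q%:R :> R. Proof. by rewrite ltr0n. Qed.

(** The bump is integrated only over the concentric box of half the side, of mass (2q)^-d, where the
    distance to the boundary exceeds 1/(4q). *)
Lemma cell_bump_mass j :
  ((c * (4 * q%:R)^-1 `^ beta * (2 * q%:R)^-1 ^+ d)%:E <= \int[U]_x (phi j x)%:E)%E.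
Proof.
pose r : R := (4 * q%:R)^-1.
have r_gt0 : 0 < r by rewrite invr_gt0 mulr_gt0.
have r2 : (2 * q%:R)^-1 - r = r by rewrite /r; field; rewrite gt_eqF.
have -> : (2 * q%:R)^-1 = 2 * r by rewrite /r; field; rewrite gt_eqF.
rewrite EFinM -(cube_uniform_cell_box q0 j); last first.
  by rewrite (ltW r_gt0) -[leRHS](subrK r) r2 lerDl ltW.
have mB := measurable_cell_box j r.
rewrite -[X in U X]setIT -(integral_indic U measurableT mB) -ge0_integralZl//; last 2 first.
- exact/measurable_EFinP/measurable_indic.
- by rewrite lee_fin mulr_ge0 ?powR_ge0// ltW.
apply: ge0_le_integral => //.
- by move=> x _; rewrite -EFinM lee_fin !mulr_ge0 ?powR_ge0 ?(ltW c0)// indicE.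
- by apply: measurable_funeM; exact/measurable_EFinP/measurable_indic.
- by apply/measurable_EFinP; exact: (measurable_funP (phi j)).
move=> x _; rewrite -EFinM lee_fin indicE.
have [|_] := boolP (x \in _); last by rewrite mulr0 cell_bump_ge0.
rewrite inE cell_boxE//= mulr1 => xr.
by apply: cell_bump_lb; rewrite ?r2// ltW.
Qed.

Let rad01 : 0 < ((2 * q%:R)^-1 : R) <= 1.
Proof.
rewrite invr_gt0 mulr_gt0//= invf_le1 ?mulr_gt0//.
have : 1 <= q%:R :> R by rewrite ler1n.
by lra.
Qed.

Lemma cell_bump_le4 j x : 0 <= phi j x <= 4^-1.
Proof.
rewrite cell_bump_ge0//= (le_trans (cell_bump_le _ _ beta01 _ _ _ _))//.
have /andP[/ltW b0 _] := beta01; have /andP[h0 h1] := rad01.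
rewrite (le_trans _ c4)// ler_piMr ?(ltW c0)//.
apply: (@le_trans _ _ (1 `^ beta)); last by rewrite powR1.
by rewrite ge0_ler_powR// nnegrE ltW.
Qed.

(** This limits what one observation reveals about a sign: the squared bump is at most its squared
    height, on a cell of mass q^-d. The error stands on the right as a summand so that all
    integrands are nonnegative. *)
Lemma cell_bump_sqr_mass j : (1%:E <= \int[U]_x (1 - 4 * phi j x ^+ 2)%:E +
   (4 * (c * (2 * q%:R)^-1 `^ beta) ^+ 2 * q%:R^-1 ^+ d)%:E)%E.
Proof.
set H := c * _; have /andP[r_gt0 _] := rad01.
have q4 : 0 <= 4 * H ^+ 2 by rewrite mulr_ge0// sqr_ge0.
have mB := measurable_cell_box j ((2 * q%:R)^-1 : R).
have -> : q%:R^-1 = 2 * (2 * q%:R)^-1 :> R by field; rewrite gt_eqF.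
rewrite EFinM -(cube_uniform_cell_box q0 j); last by rewrite (ltW r_gt0) lexx.
rewrite -[X in U X]setIT -(integral_indic U measurableT mB) -ge0_integralZl//; last first.
  exact/measurable_EFinP/measurable_indic.
rewrite -ge0_integralD//; last 4 first.
- by move=> x _; rewrite lee_fin; have /andP[] := cell_bump_le4 j x; nra.
- apply/measurable_EFinP; apply: measurable_funB => //; apply: measurable_funM => //.
  by apply: measurable_funX; exact: (measurable_funP (phi j)).
- by move=> x _; rewrite mule_ge0// lee_fin indicE.
- by apply: measurable_funeM; exact/measurable_EFinP/measurable_indic.
rewrite -[leLHS]mule1 -(probability_setT U) -integral_cst//.
apply: ge0_le_integral => //.
- apply: emeasurable_funD.
    apply/measurable_EFinP; apply: measurable_funB => //; apply: measurable_funM => //.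
    by apply: measurable_funX; exact: (measurable_funP (phi j)).
  by apply: measurable_funeM; exact/measurable_EFinP/measurable_indic.
move=> x _; rewrite /= probability_setT -EFinM -EFinD lee_fin indicE.
have := cell_bump_ge0 beta c c0 j x; have := cell_bump_le beta c beta01 c0 q0 j x.
rewrite -/(phi j x) -/H.
have [|xB] := boolP (x \in _); first by move=> _ /=; nra.
have -> : phi j x = 0; last by rewrite expr0n/= !mulr0 subr0 addr0.
apply/eqP/negP => /negP; rewrite cell_bump_neq0// => xr; move/negP: xB; apply.
by rewrite inE cell_boxE.
Qed.

(** A bump value in ]0, delta] means a distance at most r = (delta / c)^(1/beta) to the boundary of
    the cell. With s = q r, this shell has mass q^-d (1 - (1 - 2 s)^d), at most q^-d 2 d s, and s <=
    s^(alpha beta) because s < 1 and alpha beta <= 1. *)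
Lemma cell_bump_margin alpha delta j : 0 < alpha -> alpha * beta <= 1 -> 0 <= delta ->
  (U [set x | (0 < phi j x <= delta)%R] <=
   (q%:R^-1 ^+ d * (2 * d%:R) * (q%:R `^ (alpha * beta) * (delta / c) `^ alpha))%:E)%E.
Proof.
move=> alpha0 ab1 delta0; have /andP[b0 b1] := beta01.
have /andP[r1_gt0 _] := rad01; set r1 := (2 * q%:R)^-1 in r1_gt0.
have dc0 : 0 <= delta / c by rewrite divr_ge0// ltW.
pose r := (delta / c) `^ beta^-1.
have r_ge0 : 0 <= r by exact: powR_ge0.
have rb : r `^ beta = delta / c.
  by rewrite /r -powRrM mulVf ?gt_eqF// powRr1.
have ab0 : 0 <= alpha * beta by rewrite mulr_ge0// ltW.
have -> : q%:R `^ (alpha * beta) * (delta / c) `^ alpha = (q%:R * r) `^ (alpha * beta).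
  by rewrite powRM ?(ltW q_gt0)//; congr (_ * _); rewrite (mulrC alpha) powRrM rb.
set s := q%:R * r.
have s0 : 0 <= s by rewrite mulr_ge0// ltW.
set S := [set x | _].
have mS : measurable S.
  rewrite [X in measurable X](_ : _ = phi j @^-1` [set` `]0, delta]]).
    by rewrite -[X in measurable X]setTI; apply: (measurable_funP (phi j)).
  by apply/seteqP; split => x /=; rewrite in_itv.
have mB a : measurable (cell_box j a) := measurable_cell_box j a.
have SB : S `<=` cell_box j r1.
  move=> x /andP[x0 _]; rewrite cell_boxE//=.
  by rewrite -(cell_bump_neq0 beta c beta01 c0)// gt_eqF.
have UB : U (cell_box j r1) = (q%:R^-1 ^+ d)%:E.
  rewrite /U cube_uniform_cell_box ?(ltW r1_gt0) ?lexx//.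
  by congr (_ ^+ _)%:E; rewrite /r1; field; rewrite gt_eqF.
have qd0 : 0 <= q%:R^-1 ^+ d :> R by rewrite exprn_ge0// invr_ge0 ltW.
have d1 : 1 <= d%:R :> R by rewrite ler1n.
have sr : s = r / (2 * r1) by rewrite /s /r1; field; rewrite gt_eqF.
(* If [r] reaches the half-side [r1], the whole cell may count; then s >= 1/2, so that s^(alpha
   beta) >= 1/2 and 2 d s^(alpha beta) >= 1. *)
have [r1r|rr1] := leP r1 r.
  apply: (@le_trans _ _ (U (cell_box j r1))).
    by apply: le_measure; rewrite ?inE.
  rewrite UB lee_fin -mulrA ler_peMr//.
  have s2 : 2^-1 <= s.
    by rewrite sr ler_pdivlMr ?mulr_gt0// mulrA mulVf// mul1r.
  have : 2^-1 <= s `^ (alpha * beta).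
    apply: (@le_trans _ _ (2^-1 `^ (alpha * beta))).
      by apply: ger1_powR => //; apply/andP; split; lra.
    by rewrite ge0_ler_powR// nnegrE.
  by nra.
have s2 : 2 * s < 1.
  by rewrite sr mulrA -mulf_div divff// mul1r ltr_pdivrMr// mul1r.
(* On the inner box the bump exceeds [delta], so that box and [S] are disjoint parts of the cell. *)
have BB : (U S + U (cell_box j (r1 - r)) <= U (cell_box j r1))%E.
  rewrite -measureU//.
    apply: le_measure; rewrite ?inE//; first exact: measurableU.
    move=> x [/SB//|]; rewrite !cell_boxE ?subr_gt0//= => /lt_le_trans; apply.
    by rewrite gerBl.
  apply/seteqP; split => // x [/andP[_ xd]]; rewrite cell_boxE ?subr_gt0//= => xr.
  have : delta < phi j x.
    rewrite -ltr_pdivrMl// mulrC -rb gt0_ltr_powR// ?nnegrE ?le_max ?lexx//.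
    by rewrite lt_max ltrBrDl -ltrBrDr xr orbT.
  by rewrite ltNge xd.
have UB' : U (cell_box j (r1 - r)) = (q%:R^-1 ^+ d * (1 - 2 * s) ^+ d)%:E.
  rewrite /U cube_uniform_cell_box; last first.
  - by rewrite subr_ge0 (ltW rr1) gerBl.
  - by [].
  by rewrite -exprMn; congr (_ ^+ _)%:E; rewrite /s /r1; field; rewrite gt_eqF.
move: BB; rewrite UB UB' -leeBrDr// -EFinB => /le_trans; apply; rewrite lee_fin.
have : 1 - d%:R * (2 * s) <= (1 - 2 * s) ^+ d.
  by apply: bernoulli_inequality; apply/andP; split; lra.
have : s <= s `^ (alpha * beta).
  have [->|sn0] := eqVneq s 0; first exact: powR_ge0.
  by apply: ger1_powR => //; rewrite lt_neqAle eq_sym sn0 s0/=; lra.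
move=> /(ler_wpM2l (ler0n R d)) h1 h2.
rewrite -[X in X - _]mulr1 -mulrBr -mulrA ler_wpM2l//; lra.
Qed.

End cell_bump_law.

(** * Choice of the batch and conclusion *)

(* If every batch satisfied t_(i+1) < V t_i^g, then t_i would be less than V to
   the power 1 + g + ... + g^(i-1), which for i = M is a contradiction. *)
Lemma exists_long_batch (R : realType) (g : R) T M t :
    0 < g < 1 -> (1 <= M <= T)%N -> is_grid T M t ->
  exists2 i, (i < M)%N &
    T%:R `^ ((1 - g) / (1 - g ^+ M)) <=
    (nth 0%N t i.+1)%:R / Num.max 1 (nth 0%N t i)%:R `^ g.
Proof.
move=> /andP[g0 g1] /andP[M1 MT] [st t0 tM _].
have [V VE] : exists V, V = T%:R `^ ((1 - g) / (1 - g ^+ M)) by eexists.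
(* [S i] is the geometric sum 1 + g + ... + g^(i-1), so 1 + g S i = S i.+1; [V] was made opaque
   beforehand. *)
rewrite -VE; pose S i := (1 - g ^+ i) / (1 - g).
have T1 : 1 <= T%:R :> R by rewrite ler1n (leq_trans M1).
have gi1 i : g ^+ i <= 1 by rewrite exprn_ile1// ltW.
have S0 i : 0 <= S i by rewrite divr_ge0 ?subr_ge0 ?gi1 ?(ltW g1).
have gM1 : g ^+ M < 1 by rewrite exprn_ilt1 ?(ltW g0)// -lt0n.
have V1 : 1 <= V.
  rewrite VE -[leLHS](powRr0 T%:R) ler_powR// divr_ge0 ?subr_ge0 ?(ltW g1)//.
have V0 : 0 <= V by rewrite VE powR_ge0.
apply: contrapT => noi.
have ti i : (i < M)%N ->
    (nth 0%N t i.+1)%:R < V * Num.max 1 (nth 0%N t i)%:R `^ g.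
  move=> iM; rewrite ltNge; apply/negP => Vt; apply: noi; exists i => //.
  by rewrite ler_pdivlMr// powR_gt0// lt_max ltr01.
have step i : Num.max 1 (nth 0%N t i)%:R <= V `^ S i ->
    V * Num.max 1 (nth 0%N t i)%:R `^ g <= V `^ S i.+1.
  move=> IH; apply: (@le_trans _ _ (V * (V `^ S i) `^ g)).
    apply: ler_wpM2l => //; apply: ge0_ler_powR => //; first exact: ltW.
    - by rewrite nnegrE le_max ler01.
    - by rewrite nnegrE powR_ge0.
  rewrite -powRrM -{1}(powRr1 V0) -powRD; last first.
    by apply/implyP => _; rewrite gt_eqF// (lt_le_trans ltr01).
  rewrite (_ : 1 + S i * g = S i.+1)// /S exprS; field.
  by rewrite subr_eq0 gt_eqF.
have bound i : (i <= M)%N -> Num.max 1 (nth 0%N t i)%:R <= V `^ S i.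
  (* The first batch starts at time 0; the maximum with 1 turns the base case into 1 <= V^0. *)
  elim: i => [|i IH] iM.
    by rewrite t0 /S expr0 subrr mul0r powRr0 max_l.
  rewrite ge_max -[X in X <= _](powRr0 V) ler_powR//=.
  by apply: (le_trans (ltW (ti i iM))); apply: step; apply: IH; exact: ltnW.
have M0 : (M.-1 < M)%N by rewrite ltn_predL.
have := lt_le_trans (ti _ M0) (step _ (bound _ (leq_pred _))).
(* The exponent in [V] is the inverse of [S M], so the last bound reads T < T. *)
rewrite prednK// tM VE -powRrM (_ : _ * _ = 1) ?powRr1 ?ltxx//.
rewrite /S mulrA divfK ?divff// ?subr_eq0 ?gt_eqF//.
Qed.

Lemma integral_le1 d (T : measurableType d) (R : realType) (P : probability T R)
    (f : T -> R) : measurable_fun setT f -> (forall x, 0 <= f x <= 1) ->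
  (0 <= \int[P]_x (f x)%:E <= 1)%E.
Proof.
move=> mf f01; apply/andP; split.
  by apply: integral_ge0 => x _; rewrite lee_fin; case/andP: (f01 x).
apply: (@le_trans _ _ (\int[P]_x cst 1%E x)%E); last first.
  by rewrite integral_cst// mul1e probability_le1.
apply: ge0_le_integral => //.
- by move=> x _; rewrite lee_fin; case/andP: (f01 x).
- exact/measurable_EFinP.
- by move=> x _; rewrite lee_fin; case/andP: (f01 x).
Qed.

(** In [c], the term L / 2 serves smoothness across two bumps, and 1/4 gives 4 c^2 <= 1/4, which
    keeps the information of t_i observations small. *)
Lemma exists_hard_instance (R : realType) (d : nat) (beta alpha L : R)
    (hd : (1 <= d)%N) (hbeta : 0 < beta <= 1) (halpha : 0 < alpha)
    (hab : alpha * beta <= 1) (hL : 0 < L) :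
  let c := Num.min (L / 2) 4^-1 in
  let e := beta * (1 + alpha) in
  forall T M t (pi : batch_policy R d T M t) i delta0, is_grid T M t -> (i < M)%N ->
  exists I : bandit_instance R d,
    [/\ uniform_covariates I,
        bandit_class alpha beta L (2 * d%:R * c^-1 `^ alpha) delta0 I &
        ((c * 4^-1 `^ beta * 2^-1 ^+ d / 16 / 2 `^ e *
          ((nth 0 t i.+1)%:R / Num.max 1 (nth 0%N t i)%:R `^ (e / (2 * beta + d%:R))))%:E
         <= regret I pi)%E].
Proof.
move=> c e T M t pi i delta0 grid iM.
have [b0 b1] := andP hbeta.
have c0 : 0 < c by rewrite lt_min divr_gt0//= invr_gt0.
have c4 : c <= 4^-1 by rewrite ge_min lexx orbT.
have cL : c <= L / 2 by rewrite ge_min lexx.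
have d1 : 1 <= d%:R :> R by rewrite ler1n.
pose D := 2 * beta + d%:R.
have D0 : 0 < D by rewrite /D; lra.
set n := nth 0%N t i; pose y : R := n%:R `^ D^-1.
(* Rounding up gives n <= q^D, so that the signs stay hidden, while q <= 2 max(1, n)^(1/D) keeps the
   bumps large. For n = 0 it gives q = 1. *)
pose q := (Num.truncn y).+1.
have y0 : 0 <= y by exact: powR_ge0.
have [yq1 yq] := andP (truncn_itv y0).
have q0 : (0 < q)%N by [].
have qgt0 : 0 < q%:R :> R by rewrite ltr0n.
have q1 : 1 <= q%:R :> R by rewrite ler1n.
have ab0 : 0 <= alpha * beta by rewrite mulr_ge0// ltW.
(* The number of bumps before rounding; alpha beta <= 1 <= d makes it at least 1, so its integer
   part [m] is at least x / 2. *)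
pose x : R := q%:R `^ (d%:R - alpha * beta).
have x1 : 1 <= x.
  by rewrite -[leLHS](powRr0 q%:R) ler_powR//; lra.
have xqd : x <= (q ^ d)%:R.
  by rewrite natrX -powR_mulrn ?(ltW qgt0)// ler_powR// gerBl.
pose m := Num.truncn x.
have [mx xm] := andP (truncn_itv (le_trans ler01 x1)).
have m1 : (1 <= m)%N by rewrite truncn_ge_nat// (le_trans ler01).
have mq : (m <= #|{ffun 'I_d -> 'I_q}|)%N.
  by rewrite card_ffun !card_ord -(ler_nat R) (le_trans mx).
pose cell (a : 'I_m) : {ffun 'I_d -> 'I_q} := enum_val (widen_ord mq a).
have cell_inj : injective cell.
  by move=> a b /enum_val_inj /(congr1 val) /= ab; exact: val_inj.
pose phi (a : 'I_m) : {mfun covariate R d >-> measurableTypeR R} :=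
  cell_bump beta c (cell a).
have phi4 a z : 0 <= phi a z <= 4^-1 by exact: cell_bump_le4.
have phi_disj a b z : phi a z != 0 -> phi b z != 0 -> a = b.
  by move=> az bz; apply: cell_inj; exact: (cell_bump_disj beta c hbeta c0 q0 _ _ z).
pose U := cube_uniform R d.
have W01 a : (0 <= \int[U]_z (phi a z)%:E <= 1)%E.
  apply: integral_le1 => [|z]; first exact: (measurable_funP (phi a)).
  by have /andP[] := phi4 a z; move=> -> /=; lra.
have k01 a : (0 <= \int[U]_z (1 - 4 * phi a z ^+ 2)%:E <= 1)%E.
  apply: integral_le1 => [|z].
    apply: measurable_funB => //; apply: measurable_funM => //.
    by apply: measurable_funX; exact: (measurable_funP (phi a)).
  by have /andP[? ?] := phi4 a z; apply/andP; split; nra.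
have fin (r : \bar R) : (0 <= r <= 1)%E -> r \is a fin_num.
  by move=> /andP[r0 r1]; rewrite ge0_fin_numE// (le_lt_trans r1)// ltry.
pose W a := fine (\int[U]_z (phi a z)%:E)%E.
pose k a := fine (\int[U]_z (1 - 4 * phi a z ^+ 2)%:E)%E.
have phiW a : (\int[U]_z (phi a z)%:E = (W a)%:E)%E by rewrite fineK// fin.
have phik a : (\int[U]_z (1 - 4 * phi a z ^+ 2)%:E = (k a)%:E)%E by rewrite fineK// fin.
have k1 a : k a <= 1 by rewrite -lee_fin -phik; case/andP: (k01 a).
have k0 a : 0 <= k a by rewrite -lee_fin -phik; case/andP: (k01 a).
pose qb : R := q%:R `^ beta; pose qb' : R := q%:R^-1 `^ beta.
have qb_gt0 : 0 < qb by exact: powR_gt0.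
have qb'_ge0 : 0 <= qb' by exact: powR_ge0.
have qbqb' : qb * qb' = 1.
  by rewrite /qb /qb' -powRM ?invr_ge0 ?(ltW qgt0)// divff ?gt_eqF// powR1.
have qb'E : qb' = qb^-1 by apply: (mulfI (lt0r_neq0 qb_gt0)); rewrite qbqb' divff ?gt_eqF.
have qD : q%:R `^ D = qb ^+ 2 * q%:R ^+ d.
  rewrite /D powRD; last by rewrite (gt_eqF qgt0) implybT.
  rewrite powR_mulrn ?(ltW qgt0)//; congr (_ * _).
  by rewrite mulrC powRrM powR_mulrn// powR_ge0.
have nq : n%:R <= qb ^+ 2 * q%:R ^+ d.
  rewrite -qD; apply: (@le_trans _ _ (y `^ D)).
    by rewrite /y -powRrM mulVf ?gt_eqF// powRr1.
  by rewrite ge0_ler_powR ?(ltW D0) ?nnegrE ?(ltW qgt0) ?(ltW yq).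
(* [err] bounds 1 - k. It is at most q^-D / 4, hence n err <= 1/4, and the Bernoulli inequality
   gives k^n >= 3/4. *)
pose err : R := 4 * (c * (2 * q%:R)^-1 `^ beta) ^+ 2 * q%:R^-1 ^+ d.
have err0 : 0 <= err by rewrite mulr_ge0 ?exprn_ge0 ?invr_ge0 ?(ltW qgt0)// mulr_ge0 ?sqr_ge0.
have err_le : err <= 4^-1 / (qb ^+ 2 * q%:R ^+ d).
  have h : (2 * q%:R)^-1 `^ beta <= qb'.
    rewrite ge0_ler_powR ?(ltW b0) ?nnegrE ?invr_ge0 ?mulr_ge0 ?(ltW qgt0)//.
    by rewrite lef_pV2 ?posrE ?mulr_gt0//; lra.
  rewrite [leRHS](_ : _ = 4^-1 * qb' ^+ 2 * q%:R^-1 ^+ d); last first.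
    by rewrite qb'E !exprVn invfM mulrA.
  rewrite /err ler_wpM2r ?exprn_ge0 ?invr_ge0 ?(ltW qgt0)// exprMn mulrA.
  have c2 : 4 * c ^+ 2 <= 4^-1 by nra.
  apply: ler_pM => //.
  - by rewrite mulr_ge0// sqr_ge0.
  - by rewrite lerXn2r ?nnegrE// powR_ge0.
have kerr a : 1 - err <= k a.
  rewrite lerBlDr -lee_fin EFinD -phik; exact: cell_bump_sqr_mass.
have Qgt0 : 0 < qb ^+ 2 * q%:R ^+ d by rewrite mulr_gt0// exprn_gt0.
have nerr : n%:R * err <= 4^-1.
  apply: (le_trans (ler_wpM2l (ler0n R n) err_le)).
  by rewrite mulrA ler_pdivrMr// mulrC ler_wpM2l.
have err1 : err <= 1.
  apply: (le_trans err_le); rewrite ler_pdivrMr// mul1r.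
  have : 1 <= qb ^+ 2 * q%:R ^+ d; last lra.
  by rewrite -qD -[leLHS](powRr0 q%:R) ler_powR// ltW.
have kn a : 3 / 4 <= k a ^+ n.
  apply: (@le_trans _ _ ((1 - err) ^+ n)); last first.
    by rewrite lerXn2r ?nnegrE// subr_ge0.
  apply: (le_trans _ (bernoulli_inequality R err n _)); last by rewrite err0.
  by lra.
have [sigma Hsigma] := exists_bump_instance phi phi4 phi_disj pi grid W k
  phiW phik k1 i iM k0 kn.
exists (bump_instance phi phi4 phi_disj sigma); split.
- exact: bump_instance_uniform.
- split.
    apply: bump_instance_smooth; first exact: ltW.
    move=> a u v; apply: (le_trans (cell_bump_holder beta c hbeta c0 _ _ _)).
    by rewrite ler_wpM2r ?powR_ge0.
  apply: (bump_instance_margin _ _ _ _ _ _ (fun delta => q%:R^-1 ^+ d * (2 * d%:R) *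
    (q%:R `^ (alpha * beta) * (delta / c) `^ alpha))).
    by move=> delta a delta_ge0; exact: cell_bump_margin.
  move=> delta delta_ge0; rewrite card_ord.
  apply: (@le_trans _ _ (x * (q%:R^-1 ^+ d * (2 * d%:R) *
      (q%:R `^ (alpha * beta) * (delta / c) `^ alpha)))).
    apply: ler_wpM2r => //.
    by rewrite !mulr_ge0 ?powR_ge0 ?exprn_ge0 ?invr_ge0 ?(ltW qgt0)//.
  (* The number of bumps cancels the factor q^(alpha beta) q^-d of the margin of one cell, leaving a
     constant independent of q. *)
  have xE : x * q%:R `^ (alpha * beta) = q%:R ^+ d.
    rewrite /x -powRD ?subrK ?powR_mulrn ?(ltW qgt0)//.
    by rewrite (gt_eqF qgt0) implybT.
  rewrite powRM// ?invr_ge0 ?(ltW c0)//.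
  rewrite [leLHS](_ : _ = (x * q%:R `^ (alpha * beta)) * q%:R^-1 ^+ d *
     (2 * d%:R * c^-1 `^ alpha * delta `^ alpha)); last by ring.
  by rewrite xE -exprMn divff ?gt_eqF// expr1n mul1r.
apply: le_trans Hsigma; rewrite lee_fin.
pose Wmin := c * (4 * q%:R)^-1 `^ beta * (2 * q%:R)^-1 ^+ d.
have WW : m%:R * Wmin <= \sum_a W a.
  rewrite -[m in leLHS]card_ord mulr_natl -sumr_const; apply: ler_sum => a _.
  by rewrite -lee_fin -phiW; exact: cell_bump_mass.
have m2 : x / 2 <= m%:R.
  have : 1 <= m%:R :> R by rewrite ler1n.
  by move: xm; rewrite -natr1; lra.
set N1 := Num.max 1 _.
have N11 : 1 <= N1 by rewrite le_max lexx.
have N10 : 0 <= N1 by exact: le_trans N11.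
have e0 : 0 <= e by rewrite /e mulr_ge0 ?(ltW b0)//; lra.
have qY : q%:R <= 2 * N1 `^ D^-1.
  have yN1 : y <= N1 `^ D^-1.
    by rewrite ge0_ler_powR ?nnegrE ?invr_ge0 ?(ltW D0)// le_max lexx orbT.
  have : 1 <= N1 `^ D^-1 by rewrite -[leLHS](powRr0 N1) ler_powR// invr_ge0 ltW.
  by move: yq1; rewrite /q -natr1; lra.
have qe : q%:R `^ e <= 2 `^ e * N1 `^ (e / D).
  rewrite (mulrC e) [N1 `^ _]powRrM -powRM ?powR_ge0//.
  by rewrite ge0_ler_powR ?nnegrE ?(ltW qgt0)// mulr_ge0 ?powR_ge0.
have qeE : q%:R `^ e = qb * q%:R `^ (alpha * beta).
  rewrite /qb -powRD ?(gt_eqF qgt0) ?implybT//.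
  by rewrite /e mulrDr mulr1 (mulrC alpha).
(* Number times mass times height: q^(d - alpha beta) q^-d q^-beta = q^-e. *)
have WE : x * Wmin = c * 4^-1 `^ beta * 2^-1 ^+ d / q%:R `^ e.
  rewrite /Wmin !invfM powRM ?invr_ge0 ?(ltW qgt0)// exprMn -/qb' qb'E qeE.
  rewrite /x powRB ?(gt_eqF qgt0) ?implybT// powR_mulrn ?(ltW qgt0)// !exprVn.
  by field; rewrite ?gt_eqF ?powR_gt0 ?exprn_gt0.
pose K := c * 4^-1 `^ beta * 2^-1 ^+ d.
have K0 : 0 <= K by rewrite !mulr_ge0 ?powR_ge0 ?exprn_ge0 ?invr_ge0 ?(ltW c0).
rewrite -/K; set t' := (nth 0%N t i.+1)%:R.
(* The 16 is the 8 of the sign averaging times the 2 lost in m >= x / 2; the factor 2^e comes from q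
   <= 2 N1^(1/D). *)
rewrite [leLHS](_ : _ = t' * (K / (2 `^ e * N1 `^ (e / D)) / 16)); last first.
  by rewrite invfM; ring.
rewrite ler_wpM2l ?ler0n//.
have Wmin0 : 0 <= Wmin.
  by rewrite !mulr_ge0 ?powR_ge0 ?exprn_ge0 ?invr_ge0 ?mulr_ge0 ?(ltW c0) ?(ltW qgt0).
have W1 := ler_wpM2r Wmin0 m2.
have KK : K / (2 `^ e * N1 `^ (e / D)) <= x * Wmin.
  rewrite WE -/K ler_wpM2l// lef_pV2 ?posrE ?mulr_gt0 ?powR_gt0//.
  exact: lt_le_trans N11.
by move: W1; rewrite mulrAC; lra.
Qed.

Theorem theorem1 (R : realType) (d : nat) (beta alpha L : R)
    (hd : (1 <= d)%N) (hbeta : 0 < beta <= 1) (halpha : 0 < alpha)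
    (hab : alpha * beta <= 1) (hL : 0 < L) :
  let gamma := beta * (1 + alpha) / (2 * beta + d%:R) in
  exists D0 delta0 Dtilde : R,
    [/\ 0 < D0, 0 < delta0 < 1, 0 < Dtilde &
      forall T M : nat, (1 <= M <= T)%N ->
      forall t : seq nat, is_grid T M t ->
      forall pi : batch_policy R d T M t,
      exists I : bandit_instance R d,
        [/\ uniform_covariates I,
            bandit_class alpha beta L D0 delta0 I &
            ((Dtilde * T%:R `^ ((1 - gamma) / (1 - gamma ^+ M)))%R%:E
             <= regret I pi)%E]].
Proof.
move=> gamma; have [b0 b1] := andP hbeta.
have d1 : 1 <= d%:R :> R by rewrite ler1n.
pose c : R := Num.min (L / 2) 4^-1; pose e := beta * (1 + alpha).
have c0 : 0 < c by rewrite lt_min divr_gt0//= invr_gt0.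
have D0 : 0 < 2 * beta + d%:R by lra.
have g01 : 0 < gamma < 1.
  rewrite /gamma; apply/andP; split.
    by rewrite divr_gt0// mulr_gt0// addr_gt0.
  by rewrite ltr_pdivrMr// mul1r mulrDr mulr1 (mulrC beta alpha); lra.
pose C : R := c * 4^-1 `^ beta * 2^-1 ^+ d / 16 / 2 `^ e.
have C0 : 0 < C by rewrite !mulr_gt0 ?invr_gt0 ?exprn_gt0 ?powR_gt0 ?invr_gt0.
(* The margin bound of the bumps holds for every nonnegative [delta], so any [delta0] in ]0, 1[
   would do. *)
exists (2 * d%:R * c^-1 `^ alpha), 2^-1, C; split.
- by rewrite !mulr_gt0 ?powR_gt0 ?invr_gt0// (lt_le_trans ltr01).
- by apply/andP; split; lra.
- exact: C0.
move=> T M hMT t grid pi.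
have [i iM Ti] := exists_long_batch R gamma T M t g01 hMT grid.
have [I [uI cI rI]] := exists_hard_instance R d beta alpha L hd hbeta halpha hab hL
  T M t pi i 2^-1 grid iM.
exists I; split => //; apply: le_trans rI; rewrite lee_fin.
by rewrite ler_wpM2l// ltW.
Qed.
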